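(* Let $d\ge 1$ and $0<\gamma<1$. Let $X=\{X_t\}_{t\ge 0}$ be a $\gamma$-super-Brownian motion on $\mathbb{R}^d$ whose initial state $X_0$ is a non-random finite measure on $\mathbb{R}^d$. Then for each $t>0$, the measure $X_t(dx)$ is $P$-a.s. absolutely continuous with respect to Lebesgue measure on $\mathbb{R}^d$ on the event $\{t<T(X_0,1)\}$.
   Context: For a measure $\mu$ and a function $f$ on $\mathbb{R}^d$, $\langle \mu,f\rangle=\langle f,\mu\rangle=\int_{\mathbb{R}^d} f\,d\mu$. Let $p_t(x)=(2\pi t)^{-d/2}e^{-|x|^2/(2t)}$ and let $S_tf(x)=\int_{\mathbb{R}^d}p_t(x-y)f(y)\,dy$ be the semigroup of Brownian motion (generator $\frac12\Delta$). Log-Laplace semigroup: let $w(x)=C_we^{-|x|}$ with $\int_{\mathbb{R}^d} w\,dx=1$. For $f\ge 0$ a bounded Borel function that is not a.e. zero, $V_t(f)(x)=v(t,x)$ denotes the unique nonnegative solution of $$v(t,x)=(S_tf)(x)+\int_0^t (S_{t-s}v^\gamma(s,\cdot))(x)\,ds,\quad t>0,\ x\in\mathbb{R}^d,$$ that is continuous on $(0,\infty)\times\mathbb{R}^d$ and for which $t\mapsto \operatorname{ess\,sup}_x |w(x)v(t,x)|$ is essentially bounded on every compact $[a,b]\subset(0,\infty)$ (existence and uniqueness known, Aguirre and Escobedo). A $\gamma$-super-Brownian motion $X=\{X_t\}_{t\ge0}$ is the measure-valued Markov process on $\mathbb{R}^d$, defined on a filtered probability space $(\Omega,\mathcal{F},\{\mathcal{F}_t\}_{t\ge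 0},P)$ and adapted to it, characterized by $$E\big(e^{-\langle X_t,f\rangle}\,\big|\,X_0=\mu\big)=e^{-\langle\mu,V_t(f)\rangle},\quad t>0,$$ for every finite measure $\mu$ and every nonnegative bounded Borel $f$ not a.e. zero. The total mass may become infinite ($e^{-\infty}:=0$). $X$ is a Feller process and has the strong Markov property. Explosion time: $T(X_0,f)=\inf\{t\ge 0:\langle X_t,f\rangle\ge n\text{ for all } n\ge 1\}=\inf\{t\ge 0:\langle X_t,f\rangle=\infty\}$ (with $\inf\emptyset=\infty$). $T(X_0,1)$ is the explosion time of the total mass; on $\{t<T(X_0,1)\}$, $X_t$ is a finite measure. *)

(* Defs.v *)
From HB Require Import structures.
From mathcomp Require Import all_boot all_order all_algebra.
From mathcomp Require Import all_classical all_reals all_analysis.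
From mathcomp Require Import measurable_realfun ess_sup_inf giry.

Set Implicit Arguments.
Unset Strict Implicit.
Unset Printing Implicit Defensive.

Import Order.TTheory GRing.Theory Num.Theory.
Import numFieldNormedType.Exports.

Local Open Scope classical_set_scope.
Local Open Scope ring_scope.

Section borel_mx.
Context (R : realType) (m n : nat).

Definition borel_mx : set_system 'M[R]_(m, n) := <<s @open 'M[R]_(m, n) >>.

Let borel_mx0 : borel_mx set0.
Proof. exact: sigma_algebra0. Qed.

Let borel_mxC A : borel_mx A -> borel_mx (~` A).
Proof. exact: sigma_algebraC. Qed.

Let borel_mx_bigcup (F : _^nat) : (forall i, borel_mx (F i)) ->
  borel_mx (\bigcup_i F i).
Proof. exact: sigma_algebra_bigcup. Qed.

Definition borel_mx_display : measure_display.
Proof. by constructor. Qed.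

HB.instance Definition _ := @isMeasurable.Build borel_mx_display
  'M[R]_(m, n) borel_mx borel_mx0 borel_mxC borel_mx_bigcup.

End borel_mx.

Section borel_mx_measurable.
Context (R : realType).

Lemma open_mx_measurable m n (U : set 'M[R]_(m, n)) : open U -> measurable U.
Proof. exact: sub_sigma_algebra. Qed.

Lemma measurable_mx_coord m n (i : 'I_m) (j : 'I_n) :
  measurable_fun [set: 'M[R]_(m, n)] (fun A => A i j).
Proof.
apply: (measurability _ (RGenOpens.measurableE R)).
move=> _ [_ [a [b ->]] <-]; rewrite setTI; apply: open_mx_measurable.
by apply: open_comp => [A _|]; [exact: coord_continuous|exact: interval_open].
Qed.

Lemma open_mx_bigcup m n (U : set 'M[R]_(m, n)) : open U ->
  U = \bigcup_(q : 'M[rat]_(m, n)) \bigcup_(k in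
        [set k | ball (map_mx ratr q : 'M[R]_(m, n)) k.+1%:R^-1 `<=` U])
          ball (map_mx ratr q : 'M[R]_(m, n)) k.+1%:R^-1.
Proof.
move=> oU; apply/seteqP; split=> [A UA|A [q _ [k /= kU]]]; last exact: kU.
have /nbhs_ballP[e /= e0 eU] : nbhs A U by exact: open_nbhs_nbhs.
have [k k_gt] : exists k : nat, (k.+1%:R^-1 : R) < e / 2.
  have [k _ /(_ k)] := near_infty_natSinv_lt (PosNum (divr_gt0 e0 (ltr0n R 2))).
  by move=> /(_ (leqnn _)) ?; exists k.
have k0 : (0 : R) < k.+1%:R^-1 by rewrite invr_gt0.
have qA i j : exists q : rat, ball (A i j) k.+1%:R^-1 (ratr q : R).
  have /rat_in_itvoo[q] : A i j - k.+1%:R^-1 < A i j + k.+1%:R^-1.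
    by rewrite ltrD2l gtrN.
  rewrite in_itv /= => /andP[q1 q2]; exists q.
  by rewrite /ball /= ltr_distlC; apply/andP.
pose q := \matrix_(i, j) projT1 (cid (qA i j)).
have Aq : ball A k.+1%:R^-1 (map_mx ratr q : 'M[R]_(m, n)).
  by split=> // i j; rewrite !mxE; exact: (projT2 (cid (qA i j))).
exists q => //; exists k; last exact: ball_sym.
move=> /= B qB; apply: eU; rewrite [e]splitr.
apply: (@le_ball _ _ A (k.+1%:R^-1 + k.+1%:R^-1)); last exact: ball_triangle qB.
by rewrite lerD // ltW.
Qed.

Lemma measurable_fun_mx d (T : measurableType d) m n (f : T -> 'M[R]_(m, n)) :
  (forall i j, measurable_fun [set: T] (fun t => f t i j)) ->
  measurable_fun [set: T] f.
Proof.
move=> mf; apply: (@measurability _ _ _ _ _ _ (@open 'M[R]_(m, n))) => //.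
move=> _ [U oU <-]; rewrite setTI (open_mx_bigcup oU) preimage_bigcup.
apply: countable_bigcupT_measurable => [|q]; first exact: countableP.
rewrite preimage_bigcup; apply: bigcup_measurable => k _.
set c := map_mx ratr q.
rewrite [X in measurable X](_ : _ =
    \bigcap_(i in [set: 'I_m]) \bigcap_(j in [set: 'I_n])
      ((fun t => f t i j) @^-1` ball (c i j) k.+1%:R^-1)); last first.
  apply/seteqP; split=> [t [_ ct] i _ j _|t ct]; first exact: ct.
  by split=> [|i j]; [rewrite invr_gt0|exact: ct].
apply: fin_bigcap_measurable => // i _; apply: fin_bigcap_measurable => // j _.
rewrite -[X in measurable X]setTI; apply: mf => //.
exact: measurable_ball.
Qed.

End borel_mx_measurable.

(* The library proves this, but its instance is shadowed by the one for
   products of subprobability measures. *)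
Lemma sigma_finite_product_measure1 d1 d2 (T1 : measurableType d1)
    (T2 : measurableType d2) (R : realType)
    (m1 : {sigma_finite_measure set T1 -> \bar R})
    (m2 : {sigma_finite_measure set T2 -> \bar R}) :
  sigma_finite setT (m1 \x m2)%E.
Proof.
have /sigma_finiteP[F [TF ndF Foo]] := sigma_finiteT m1.
have /sigma_finiteP[G [TG ndG Goo]] := sigma_finiteT m2.
exists (fun n => F n `*` G n).
  rewrite -setXTT TF TG predeqE => -[x y]; split.
    move=> [/= [n _ Fnx] [k _ Gky]]; exists (maxn n k) => //; split.
    - by move: x Fnx; exact/subsetPset/ndF/leq_maxl.
    - by move: y Gky; exact/subsetPset/ndG/leq_maxr.
  by move=> [n _ []/= ? ?]; split; exists n.
move=> k; have [? ?] := Foo k; have [? ?] := Goo k.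
split; first exact: measurableX.
by rewrite product_measure1E// lte_mul_pinfty// ge0_fin_numE.
Qed.

Section lebesgue_row.
Context (R : realType) (n : nat).
Variable mu : {sigma_finite_measure set 'rV[R]_n -> \bar R}.

Definition cons_row (z : R * 'rV[R]_n) : 'rV[R]_n.+1 :=
  \row_j oapp (fun k => z.2 ord0 k) z.1 (unlift ord0 j).

Lemma measurable_cons_row : measurable_fun setT cons_row.
Proof.
apply: measurable_fun_mx => i j; rewrite /cons_row.
under eq_fun do rewrite mxE.
case: unliftP => [k|] _ /=; last exact: measurable_fst.
exact: (measurableT_comp (measurable_mx_coord _ _)).
Qed.

Definition lebesgue_cons : set 'rV[R]_n.+1 -> \bar R :=
  pushforward (lebesgue_measure \x mu)%E cons_row.

Let mcons A : measurable A -> measurable (cons_row @^-1` A).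
Proof. by move=> mA; rewrite -[X in measurable X]setTI; exact: measurable_cons_row. Qed.

Let lebesgue_cons0 : lebesgue_cons set0 = 0%E.
Proof. by rewrite /lebesgue_cons /pushforward preimage_set0 measure0. Qed.

Let lebesgue_cons_ge0 A : (0 <= lebesgue_cons A)%E.
Proof. by rewrite /lebesgue_cons /pushforward; exact: measure_ge0. Qed.

Let lebesgue_cons_sigma_additive : semi_sigma_additive lebesgue_cons.
Proof.
move=> F mF tF mUF; rewrite /lebesgue_cons /pushforward preimage_bigcup.
apply: measure_semi_sigma_additive => [k||]; first exact: mcons.
- apply/trivIsetP => /= i j _ _ ij; rewrite -preimage_setI.
  by move/trivIsetP : tF => /(_ _ _ _ _ ij) ->//; rewrite preimage_set0.
- by rewrite -preimage_bigcup; exact: mcons.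
Qed.

HB.instance Definition _ := isMeasure.Build _ _ _ lebesgue_cons
  lebesgue_cons0 lebesgue_cons_ge0 lebesgue_cons_sigma_additive.

Let uncons (v : 'rV[R]_n.+1) : R * 'rV[R]_n :=
  (v ord0 ord0, \row_j v ord0 (lift ord0 j)).

Let measurable_uncons : measurable_fun setT uncons.
Proof.
apply: measurable_fun_pair; first exact: measurable_mx_coord.
apply: measurable_fun_mx => i j; under eq_fun do rewrite mxE.
exact: measurable_mx_coord.
Qed.

Let cons_rowK : cancel cons_row uncons.
Proof.
move=> [x v]; rewrite /uncons /cons_row /= mxE unlift_none /=; congr pair.
by apply/rowP => j; rewrite !mxE liftK.
Qed.

Let lebesgue_cons_sigma_finite : sigma_finite setT lebesgue_cons.
Proof.
have [F FT Foo] : sigma_finite setT (lebesgue_measure \x mu)%E.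
  exact: sigma_finite_product_measure1.
exists (fun k => uncons @^-1` F k); first by rewrite -preimage_bigcup -FT.
move=> k; have [mF Fk] := Foo k; split.
  by rewrite -[X in measurable X]setTI; exact: measurable_uncons.
rewrite /lebesgue_cons /pushforward -comp_preimage.
by rewrite (_ : uncons \o cons_row = id)//; apply/funext/cons_rowK.
Qed.

HB.instance Definition _ := Measure_isSigmaFinite.Build _ _ _ lebesgue_cons
  lebesgue_cons_sigma_finite.

End lebesgue_row.

Fixpoint lebesgue_row (R : realType) (n : nat) :
    {sigma_finite_measure set 'rV[R]_n -> \bar R} :=
  match n with
  | 0 => \d_(0 : 'rV[R]_0)
  | n'.+1 => lebesgue_cons (lebesgue_row R n')
  end.

Lemma lebesgue_row_box (R : realType) (n : nat) (a b : 'rV[R]_n) :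
  (forall j, a ord0 j <= b ord0 j) ->
  lebesgue_row R n [set x : 'rV[R]_n | forall j, x ord0 j \in `[a ord0 j, b ord0 j]]
  = (\prod_j (b ord0 j - a ord0 j))%:E.
Proof.
elim: n a b => [|n IHn] a b ab.
  rewrite big_ord0 /= diracE mem_set//; by case.
pose a' : 'rV[R]_n := \row_j a ord0 (lift ord0 j).
pose b' : 'rV[R]_n := \row_j b ord0 (lift ord0 j).
rewrite big_ord_recl/= /lebesgue_cons /pushforward.
have -> : cons_row (n := n) @^-1`
      [set x : 'rV[R]_n.+1 | forall j, x ord0 j \in `[a ord0 j, b ord0 j]] =
    `[a ord0 ord0, b ord0 ord0]%classic `*`
    [set x : 'rV[R]_n | forall j, x ord0 j \in `[a' ord0 j, b' ord0 j]].
  apply/seteqP; split=> [[x v]/= h|[x v]/= [hx hv] j].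
    split=> [|j]; first by have := h ord0; rewrite mxE unlift_none.
    by have := h (lift ord0 j); rewrite !mxE liftK.
  rewrite mxE; case: unliftP => [k|] -> //=.
  by have := hv k; rewrite !mxE.
rewrite product_measure1E//; last first.
  rewrite [X in measurable X](_ : _ = \bigcap_(j in [set: 'I_n])
      ((fun x : 'rV[R]_n => x ord0 j) @^-1` `[a' ord0 j, b' ord0 j])).
    apply: fin_bigcap_measurable => // j _; rewrite -[X in measurable X]setTI.
    exact: measurable_mx_coord.
  by apply/seteqP; split=> x /= h j; [move=> _|]; exact: h.
rewrite IHn; last by move=> j; rewrite !mxE.
transitivity (lebesgue_measure `[a ord0 ord0, b ord0 ord0]%classic *
    (\prod_j (b' ord0 j - a' ord0 j))%:E)%E; first by [].
have -> : lebesgue_measure `[a ord0 ord0, b ord0 ord0]%classic =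
    (b ord0 ord0 - a ord0 ord0)%:E.
  rewrite lebesgue_measure_itv/= lte_fin.
  have := ab ord0; rewrite le_eqVlt => /predU1P[->|->]; last by rewrite -EFinB.
  by rewrite ltxx subrr.
rewrite EFinM; congr (_ * (_)%:E)%E.
by apply: eq_bigr => j _; rewrite !mxE.
Qed.

Section log_laplace.
Context (R : realType) (d : nat).
Implicit Types (x y : 'rV[R]_d) (f : 'rV[R]_d -> R).

Local Notation lebesgue := (lebesgue_row R d).

(* The library's norm on ['rV[R]_d] is the sup norm. *)
Definition euclidean_norm x : R := Num.sqrt (\sum_(j < d) x ord0 j ^+ 2).

Definition heat_kernel (t : R) x : R :=
  (2 * pi * t) `^ (- (d%:R / 2)) * expR (- (euclidean_norm x ^+ 2 / (2 * t))).

Definition heat_semigroup (t : R) f x : \bar R :=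
  \int[lebesgue]_y (heat_kernel t (x - y) * f y)%:E.

Definition test_function f : Prop :=
  [/\ measurable_fun [set: 'rV[R]_d] f,
      forall x, 0 <= f x,
      exists M, forall x, f x <= M
    & ~ {ae lebesgue, forall x, f x = 0}].

(* The constant [C] below is the [C_w] of the weight [w(x) = C_w e^{-|x|}].
   The values of [v] at times [t <= 0] are irrelevant. *)
Record log_laplace_solution (gamma : R) f (v : R -> 'rV[R]_d -> R) : Prop := {
  lls_ge0 : forall (t : R) x, 0 < t -> 0 <= v t x ;
  lls_continuous :
    {within [set z : R * 'rV[R]_d | 0 < z.1], continuous (fun z => v z.1 z.2)} ;
  lls_bounded : exists2 C : R,
    (\int[lebesgue]_x (C * expR (- euclidean_norm x))%:E = 1)%E &
    forall a b : R, 0 < a -> a <= b -> exists M : R,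
      {ae lebesgue_measure, forall t : measurableTypeR R, t \in `[a, b] ->
        (ess_sup lebesgue (fun x =>
           `| C * expR (- euclidean_norm x) * v t x |%:E) <= M%:E)%E} ;
  lls_eq : forall (t : R) x, 0 < t ->
    ((v t x)%:E = heat_semigroup t f x +
       \int[lebesgue_measure]_(s in `]0%R, t[)
         heat_semigroup (t - s)%R (fun y => v s y `^ gamma)%R x)%E
}.

(* [V t f x] is [V_t(f)(x)]. It is pinned down by the definite description "the
   unique solution"; existence and uniqueness are due to Aguirre and Escobedo. *)
Definition log_laplace_semigroup (gamma : R)
    (V : R -> ('rV[R]_d -> R) -> 'rV[R]_d -> R) : Prop :=
  forall f, test_function f ->
    log_laplace_solution gamma f (fun t => V t f) /\
    forall u, log_laplace_solution gamma f u ->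
      forall (t : R) x, 0 < t -> u t x = V t f x.

End log_laplace.

Section measure_space.
Context d (T : measurableType d) (R : realType).

(* No finiteness is imposed: a super-Brownian motion with branching exponent
   below 1 reaches measures of infinite total mass. *)
Definition measure_space : Type := {measure set T -> \bar R}.

HB.instance Definition _ := gen_eqMixin measure_space.
HB.instance Definition _ := gen_choiceMixin measure_space.
HB.instance Definition _ := isPointed.Build measure_space mzero.

Definition measure_space_eval (A : set T) (mu : measure_space) : \bar R := mu A.

Definition measure_space_measurable : set_system measure_space :=
  <<s \bigcup_(A in measurable)
        preimage_set_system setT (measure_space_eval A) measurable >>.

Let msm0 : measure_space_measurable set0.
Proof. exact: sigma_algebra0. Qed.

Let msmC A : measure_space_measurable A -> measure_space_measurable (~` A).
Proof. exact: sigma_algebraC. Qed.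

Let msm_bigcup (F : _^nat) : (forall i, measure_space_measurable (F i)) ->
  measure_space_measurable (\bigcup_i F i).
Proof. exact: sigma_algebra_bigcup. Qed.

Definition measure_space_display : measure_display.
Proof. by constructor. Qed.

HB.instance Definition _ := @isMeasurable.Build measure_space_display
  measure_space measure_space_measurable msm0 msmC msm_bigcup.

End measure_space.

Section markov.
Context (R : realType) dO (Omega : measurableType dO) (P : probability Omega R).
Context dE (E : measurableType dE).

Definition filtration (F : R -> set_system Omega) : Prop :=
  [/\ forall t : R, 0 <= t -> sigma_algebra setT (F t),
      forall t : R, 0 <= t -> F t `<=` measurable
    & forall s t : R, 0 <= s -> s <= t -> F s `<=` F t].

Definition adapted (F : R -> set_system Omega) (X : R -> Omega -> E) : Prop :=
  forall t : R, 0 <= t -> forall B, measurable B -> F t (X t @^-1` B).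

Definition transition_semigroup (Q : R -> R.-pker E ~> E) : Prop :=
  (forall x B, measurable B -> Q 0 x B = \d_x B) /\
  (forall (s t : R) x B, 0 <= s -> 0 <= t -> measurable B ->
    Q (s + t) x B = (\int[Q s x]_y Q t y B)%E).

(* [P(X_t \in B | F_s) = Q_(t - s)(X_s, B)] *)
Definition markov_property (F : R -> set_system Omega) (Q : R -> R.-pker E ~> E)
    (X : R -> Omega -> E) : Prop :=
  forall (s t : R) A B, 0 <= s -> s <= t -> F s A -> measurable B ->
    P (A `&` X t @^-1` B) = (\int[P]_(w in A) Q (t - s)%R (X s w) B)%E.

End markov.

Section super_brownian_motion.
Context (R : realType) (d : nat).

Local Notation state := (measure_space 'rV[R]_d R).

(* [E(e^{-<X_t, f>} | X_0 = mu)] is the integral of [e^{-<., f>}] against the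
   transition probability [Q t mu]; [expeR -oo = 0]. *)
Definition log_laplace_transition (V : R -> ('rV[R]_d -> R) -> 'rV[R]_d -> R)
    (Q : R -> R.-pker state ~> state) : Prop :=
  forall (t : R) (mu : {finite_measure set 'rV[R]_d -> \bar R})
         (f : 'rV[R]_d -> R),
    0 < t -> test_function f ->
    (\int[Q t (mu : {measure set 'rV[R]_d -> \bar R})]_nu
        expeR (- \int[nu : state]_x (f x)%:E)
     = expeR (- \int[mu]_x (V t f x)%:E))%E.

Definition super_brownian_motion (V : R -> ('rV[R]_d -> R) -> 'rV[R]_d -> R)
    dO (Omega : measurableType dO) (P : probability Omega R)
    (F : R -> set_system Omega) (X : R -> Omega -> state) : Prop :=
  [/\ filtration F, adapted F X &
    exists Q : R -> R.-pker state ~> state,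
      [/\ transition_semigroup Q, log_laplace_transition V Q
        & markov_property P F Q X]].

Definition explosion_time dO (Omega : measurableType dO)
    (X : R -> Omega -> state) (f : 'rV[R]_d -> R) (w : Omega) : \bar R :=
  ereal_inf [set t%:E | t in
    [set t : R | 0 <= t /\ (\int[X t w]_x (f x)%:E = +oo)%E]].

End super_brownian_motion.

(* Main.v *)
Require Import Defs.
From HB Require Import structures.
From mathcomp Require Import all_boot all_order all_algebra.
From mathcomp Require Import all_classical all_reals all_analysis.
From mathcomp Require Import measurable_realfun ess_sup_inf giry.
From mathcomp Require Import ring lra.

Set Implicit Arguments.
Unset Strict Implicit.
Unset Printing Implicit Defensive.

Import Order.TTheory GRing.Theory Num.Theory.
Import numFieldNormedType.Exports.

Local Open Scope classical_set_scope.
Local Open Scope ring_scope.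

(* Write v_theta(t) = (theta^(1-gamma) + (1-gamma) t)^(1/(1-gamma)), which is V_t of
   the constant theta. Given X_0 = nu, convexity of the exponential bounds
   E[X_t(1) e^{-X_t(1)}] by (e^{-|nu| v_a(t)} - e^{-|nu| v_1(t)}) / (1 - a), a < 1,
   while V_t(1 + f) >= v_1(t) + S_t f bounds the Laplace functional of the masses of
   small cubes from below. For small t the two bounds nearly agree, uniformly in nu
   because of the damping e^{-X_t(1)}. Hence the nonnegative functional
     D(eta) = sum_Q (eta(Q) - |Q| (1 - e^{-l eta(Q)/|Q|}) / l),
   summed over the dyadic cubes Q of a given size, has arbitrarily small damped
   expectation after a short time, uniformly in the size of the cubes. On the other
   hand, as the cubes shrink D(eta) stays bounded away from 0, uniformly in l, when
   eta has a singular part. The Markov property is used at times t - delta, with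
   delta -> 0, on the event that the mass is still finite. *)

(** * Measures of finite total mass as bundled finite measures *)

Section finite_measure_of.
Context d (T : measurableType d) (R : realType).
Variable nu : {measure set T -> \bar R}.
Hypothesis nu_fin : (nu setT < +oo)%E.

Let nu_fin_num_fun : fin_num_fun nu.
Proof.
move=> A mA; rewrite ge0_fin_numE//; apply: le_lt_trans nu_fin.
by apply: le_measure; rewrite ?inE.
Qed.

Let nu_isSFinite : isSFinite d T R (Measure.sort nu).
Proof.
split; apply: sfinite_measure_sigma_finite.
by apply: fin_num_fun_sigma_finite; rewrite ?measure0.
Qed.

Let nu_isSigmaFinite : isSigmaFinite d T R (Measure.sort nu).
Proof. by split; apply: fin_num_fun_sigma_finite; rewrite ?measure0. Qed.

Let nu_isFinite : isFinite d T R (Measure.sort nu).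
Proof. by split. Qed.

(** States of the process are bare measures that may be infinite; this supplies the bundled
    structure once the total mass is known to be finite. *)
Definition finite_measure_of : {finite_measure set T -> \bar R} :=
  HB.pack_for (FiniteMeasure.type T R) (Measure.sort nu)
    nu_isSFinite nu_isSigmaFinite nu_isFinite.

Lemma finite_measure_ofE : (finite_measure_of : {measure set T -> \bar R}) = nu.
Proof. exact: eq_measure. Qed.

End finite_measure_of.

(** * Approximation of measurable sets by a generating algebra *)

Section algebra_approximation.
Context d (T : measurableType d) (R : realType).
Variable mu : {finite_measure set T -> \bar R}.
Variable G : set_system T.
Hypothesis G0 : G set0.
Hypothesis GC : forall A, G A -> G (~` A).
Hypothesis GU : forall A B, G A -> G B -> G (A `|` B).
Hypothesis Gm : G `<=` measurable.

Let approx (A : set T) : Prop :=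
  measurable A /\ forall e : R, 0 < e -> exists2 W, G W & (mu (A `+` W) < e%:E)%E.

Let measurable_setY (A B : set T) :
  measurable A -> measurable B -> measurable (A `+` B).
Proof. by move=> mA mB; rewrite setY_def; apply: measurableU; exact: measurableD. Qed.

Let approxU A B : approx A -> approx B -> approx (A `|` B).
Proof.
move=> [mA hA] [mB hB]; split=> [|e e0]; first exact: measurableU.
have e20 : 0 < e / 2 by rewrite divr_gt0.
have [V GV VA] := hA _ e20; have [W GW WB] := hB _ e20.
exists (V `|` W); first exact: GU.
have mV := Gm GV; have mW := Gm GW.
rewrite [e]splitr EFinD; apply: le_lt_trans (lteD VA WB).
apply: (le_trans _ (measureU2 _ _ _)); [|exact: measurable_setY..].
apply: le_measure; rewrite ?inE.
- by apply: measurable_setY; exact: measurableU.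
- by apply: measurableU; exact: measurable_setY.
by rewrite !setY_def => x /=; tauto.
Qed.

(** The sets that can be approximated form a sigma-algebra containing [G]: complements leave
    symmetric differences unchanged, and a countable union is filled up to [e / 2] by a finite
    partial union, since [mu] is finite and hence continuous from above. *)
Lemma measurable_approx_algebra (A : set T) (e : R) : <<s G >> A -> 0 < e ->
  exists2 W, G W & (mu (A `+` W) < e%:E)%E.
Proof.
move=> sA; suff [_] : approx A by exact.
move: A sA {e}; apply: smallest_sub => [|A GA]; last first.
  split=> [|e e0]; first exact: Gm.
  exists A => //; rewrite setY_def setDv setU0 measure0 lte_fin//.
split.
- split=> // e e0; exists set0 => //.
  by rewrite setY_def setDv setU0 measure0 lte_fin.
- move=> A [mA hA]; rewrite setTD; split=> [|e e0]; first exact: measurableC.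
  have [W GW WA] := hA e e0; exists (~` W); first exact: GC.
  suff -> : ~` A `+` ~` W = A `+` W by [].
  rewrite !setY_def; apply/seteqP; split=> x /=;
    by case: (pselect (A x)); case: (pselect (W x)); tauto.
- move=> F hF.
  have mF k : measurable (F k) by case: (hF k).
  have mUF := bigcup_measurable (fun k _ => mF k).
  split=> // e e0; have e20 : 0 < e / 2 by rewrite divr_gt0.
  pose S n := \big[setU/set0]_(i < n) F i.
  have aS n : approx (S n).
    rewrite /S; elim: n => [|n IH]; last by rewrite big_ord_recr/=; exact: approxU.
    rewrite big_ord0; split=> // r r0; exists set0 => //.
    by rewrite setY_def setDv setU0 measure0 lte_fin.
  have mS n : measurable (S n) by case: (aS n).
  have [n nS] : exists n, (mu (\bigcup_k F k `\` S n) < (e / 2)%:E)%E.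
    have : mu (\bigcup_k F k `\` S n) @[n --> \oo] --> mu (\bigcap_n (\bigcup_k F k `\` S n)).
      apply: nonincreasing_cvg_mu => [|n||m n mn].
      - by rewrite ltey_eq fin_num_measure//; exact: measurableD.
      - exact: measurableD.
      - by apply: bigcapT_measurable => n; exact: measurableD.
      - apply/subsetPset; apply: setDS; exact: subset_bigsetU.
    rewrite (_ : \bigcap_n _ = set0) ?measure0; last first.
      rewrite -subset0 => x /= h; have [[k _ Fkx] _] := h 0%N I.
      have [_] := h k.+1 I; apply; rewrite /S -bigcup_mkord; exists k => //=.
    move=> /fine_cvgP[_] /cvgrPdist_lt /(_ _ e20)[N _ /(_ N (leqnn _))] /=.
    rewrite sub0r normrN ger0_norm ?fine_ge0// => h; exists N.
    rewrite -[X in (X < _)%E]fineK ?lte_fin// fin_num_measure//.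
    exact: measurableD.
  have [_ /(_ _ e20)[W GW WS]] := aS n; exists W => //.
  rewrite [e]splitr EFinD; apply: le_lt_trans (lteD nS WS).
  have mW := Gm GW.
  apply: (le_trans _ (measureU2 _ _ _)); [|exact: measurableD|exact: measurable_setY].
  apply: le_measure; rewrite ?inE.
  + exact: measurable_setY.
  + by apply: measurableU; [exact: measurableD|exact: measurable_setY].
  have SF : S n `<=` \bigcup_k F k by rewrite /S -bigcup_mkord => x [k _ ?]; exists k.
  rewrite !setY_def => x /=; have := SF x.
  by case: (pselect (S n x)); tauto.
Qed.

End algebra_approximation.

(** * The defect of a single cell *)

(** The summand of the functional D, for a cell of reference mass [q] and mass [a]. It equals [a]
    when [q = 0]. *)
Definition defect (R : realType) (l q a : R) : R :=
  a - q / l * (1 - expR (- (l * a / q))).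

Section defect_lemmas.
Context (R : realType).
Implicit Types l q a : R.

Lemma defect_ge0 l q a : 0 < l -> 0 <= q -> 0 <= a -> 0 <= defect l q a.
Proof.
move=> l0 q0 a0; rewrite /defect subr_ge0.
have [->|qn0] := eqVneq q 0; first by rewrite !mul0r.
have h := expR_ge1Dx (- (l * a / q)).
have aE : q / l * (l * a / q) = a by field; rewrite qn0 gt_eqF.
rewrite -[leRHS]aE; apply: ler_wpM2l; first by rewrite divr_ge0// ltW.
by move: h; set u := l * a / q; set w := expR _; lra.
Qed.

(** Since 1 - e^{-u} <= 1, a cell hides at most [q / l] of its mass from the defect, so mass
    concentrated on cells of small [q] is detected. *)
Lemma ge_defect l q a : 0 < l -> 0 <= q -> a - q / l <= defect l q a.
Proof.
move=> l0 q0; rewrite /defect lerD2l lerN2; apply: ler_piMr; first by rewrite divr_ge0// ltW.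
by rewrite lerBlDr lerDl expR_ge0.
Qed.

End defect_lemmas.

(** * Nested partitions and the detection of a singular part *)

Section cells.
Context d (T : measurableType d) (R : realType).
Variable m : {measure set T -> \bar R}.
Variable c : nat -> T -> nat.

(** A partition is encoded by a labelling of the points by natural numbers: cells of one level are
    then disjoint and cover the space, and some may be empty. *)
Definition cell n k : set T := c n @^-1` [set k].

(** An infinite mass is read as 0 by [fine]. This functional is applied to finite measures, or with
    a damping factor that vanishes when the total mass is infinite. *)
Definition total_defect (l : R) n (nu : {measure set T -> \bar R}) : \bar R :=
  (\sum_(k <oo) (defect l (fine (m (cell n k))) (fine (nu (cell n k))))%:E)%E.

(** Unions of cells of a common level; once the levels refine each other, these sets form an
    algebra. *)
Definition level_sets : set_system T := [set W | exists n J, W = c n @^-1` J].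

Hypothesis measurable_cell : forall n k, measurable (cell n k).

Lemma level_bigcup n (J : set nat) : c n @^-1` J = \bigcup_(k in J) cell n k.
Proof. by apply/seteqP; split=> [x Jx|x [k Jk /= ->]//]; exists (c n x). Qed.

Lemma trivIset_cell n (J : set nat) : trivIset J (cell n).
Proof. by move=> i j _ _ [x []]; rewrite /cell/= => -> ->. Qed.

Lemma measurable_level : level_sets `<=` measurable.
Proof.
move=> _ [n [J ->]]; rewrite level_bigcup; exact: bigcup_measurable.
Qed.

Lemma measure_level (nu : {measure set T -> \bar R}) n (J : set nat) :
  nu (c n @^-1` J) = (\sum_(k <oo | k \in J) nu (cell n k))%E.
Proof.
rewrite level_bigcup measure_bigcup//; exact: trivIset_cell.
Qed.

Lemma measure_setT_cells (nu : {measure set T -> \bar R}) n :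
  nu setT = (\sum_(k <oo) nu (cell n k))%E.
Proof.
rewrite -(preimage_setT (c n)) measure_level; apply: eq_eseriesl => k.
by rewrite in_setT.
Qed.

Hypothesis cell_fin : forall n k, (m (cell n k) < +oo)%E.
Hypothesis cell_refine : forall n x y, c n.+1 x = c n.+1 y -> c n x = c n y.
Hypothesis cell_generate : measurable `<=` <<s level_sets >>.

Let cell_refine_le n p x y : (n <= p)%N -> c p x = c p y -> c n x = c n y.
Proof.
move=> /subnK <-; elim: (p - n)%N => // j IH; rewrite addSn => /cell_refine.
exact: IH.
Qed.

Let level_refine n p (J : set nat) : (n <= p)%N ->
  exists J', c n @^-1` J = c p @^-1` J'.
Proof.
move=> np; exists (c p @` (c n @^-1` J)).
apply/seteqP; split=> [x Jx|x [y Jy] /(cell_refine_le np)]; first by exists x.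
by rewrite /= => <-.
Qed.

Let level0 : level_sets set0.
Proof. by exists 0%N, set0; rewrite preimage_set0. Qed.

Let levelC A : level_sets A -> level_sets (~` A).
Proof. by move=> [n [J ->]]; exists n, (~` J). Qed.

Let levelU A B : level_sets A -> level_sets B -> level_sets (A `|` B).
Proof.
move=> [n [J ->]] [p [K ->]].
have [J' ->] := level_refine J (leq_maxl n p).
by have [K' ->] := level_refine K (leq_maxr n p); exists (maxn n p), (J' `|` K').
Qed.

(* The part of [nu] carried by an [m]-null set [N] concentrates, up to [e], on a
   union of cells of total [m]-mass [e], where [defect] is at least [a - q / l]. *)
Lemma total_defect_bounded_below (nu : {finite_measure set T -> \bar R}) :
  ~ nu `<< m ->
  exists2 r : R, 0 < r & forall l : R, 0 < l ->
    exists n0, forall n, (n0 <= n)%N -> (r%:E <= total_defect l n nu)%E.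
Proof.
move=> /null_content_dominatesP; rewrite /content_dominates => numu.
have [N0 [mN0 N00 nuN0]] : exists N0, [/\ measurable N0, m N0 = 0%E & nu N0 <> 0%E].
  apply: contrapT => h; apply: numu => A mA A0; apply: contrapT => nuA.
  by apply: h; exists A.
(* Some cell of level 0 still meets [N0] in positive [nu]-mass; on it [m] is finite, as the
   approximation requires. *)
have [k0 nuk0] : exists k0, nu (N0 `&` cell 0 k0) <> 0%E.
  apply: contrapT => /forallNP h; apply: nuN0.
  have -> : N0 = \bigcup_k (N0 `&` cell 0 k).
    by rewrite -setI_bigcupr -level_bigcup preimage_setT setIT.
  rewrite measure_bigcup//; last 2 first.
  - by move=> k _; exact: measurableI.
  - by move=> i j _ _ [x [[_ +] [_ +]]]; rewrite /cell/= => -> ->.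
  by apply: eseries0 => k _ _; apply: contrapT; exact: h.
set B := cell 0 k0 in nuk0; set N := N0 `&` B in nuk0.
have mB : measurable B by exact: measurable_cell.
have mN : measurable N by exact: measurableI.
have finN : nu N \is a fin_num by exact: fin_num_measure.
have r0 : 0 < fine (nu N) 
  by rewrite fine_gt0// ltey_eq finN andbT lt0e measure_ge0 andbT; apply/eqP.
exists (fine (nu N) / 2); first by rewrite divr_gt0.
move=> l l0.
(* Adding the two measures lets one approximating set serve for [nu] and for [m] at once. *)
pose rho := measure_add nu (mrestr m (measurable_cell 0 k0)).
have rhoE A : rho A = (nu A + m (A `&` B))%E by rewrite /rho measure_addE.
have rhofin : (rho setT < +oo)%E.
  rewrite rhoE setTI lte_add_pinfty ?cell_fin//.
  by rewrite ltey_eq fin_num_measure.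
(* Chosen so that [e / l + e] is half of [nu N]: the level reached depends on [l], the lower bound
   does not. *)
pose e := fine (nu N) / 2 / (1 + l^-1).
have il0 : 0 < l^-1 by rewrite invr_gt0.
have e0 : 0 < e by rewrite divr_gt0 ?divr_gt0// addr_gt0.
have [W [n1 [J WE]] rhoW] : exists2 W, level_sets W & (rho (N `+` W) < e%:E)%E.
  exact: (@measurable_approx_algebra _ _ _ (finite_measure_of rhofin) level_sets
    level0 levelC levelU measurable_level _ _ (cell_generate mN) e0).
rewrite rhoE in rhoW.
exists n1 => n n1n.
(* From level [n1] on, the part of [W] inside [B] is a union of cells of level [n]. *)
have [J1 J1E] := level_refine J n1n.
have [J2 J2E] := level_refine [set k0] (leq0n n).
pose J' := J1 `&` J2.
have WBE : W `&` B = c n @^-1` J' by rewrite WE J1E /B /cell J2E.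
have mW : measurable W by apply: measurable_level; exists n1, J.
have mNW : measurable (N `+` W) by rewrite setY_def; apply: measurableU; exact: measurableD.
have nuW : (nu N <= nu (W `&` B) + nu (N `+` W))%E.
  apply: (le_trans _ (measureU2 _ (measurableI _ _ _ _) _)) => //.
  apply: le_measure; rewrite ?inE//; first by apply: measurableU => //; exact: measurableI.
  rewrite setY_def => x [N0x Bx].
  by case: (pselect (W x)) => Wx; [left|right; left].
have mWB : (m (W `&` B) <= m ((N `+` W) `&` B))%E.
  apply: (@le_trans _ _ (m N0 + m ((N `+` W) `&` B))%E); last by rewrite N00 add0e.
  apply: (le_trans _ (measureU2 _ _ (measurableI _ _ _ _))) => //.
  apply: le_measure; rewrite ?inE//; first exact: measurableI.
    by apply: measurableU => //; exact: measurableI.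
  rewrite setY_def => x [Wx Bx]; have [N0x|N0x] := pselect (N0 x); first by left.
  by right; split=> //; right; split=> // -[].
(* [ge_defect] summed over the cells of [J']; the remaining cells contribute nonnegative defects. *)
have key : (nu (W `&` B) <= total_defect l n nu + (l^-1)%:E * m (W `&` B))%E.
  rewrite WBE !measure_level -nneseriesZl//.
  apply: (@le_trans _ _ (\sum_(k <oo | k \in J')
      ((defect l (fine (m (cell n k))) (fine (nu (cell n k))))%:E +
       (l^-1)%:E * m (cell n k)))%E).
    apply: lee_nneseries => // k _.
    rewrite -[X in (X <= _)%E]fineK ?fin_num_measure//.
    rewrite -[X in (_ <= _ + _ * X)%E]fineK; last by rewrite ge0_fin_numE.
    rewrite -EFinM -EFinD lee_fin -lerBlDr mulrC; exact: ge_defect.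
  have dge0 k : (0 <= (defect l (fine (m (cell n k))) (fine (nu (cell n k))))%:E)%E.
    by rewrite lee_fin defect_ge0// fine_ge0.
  rewrite nneseriesD//; last by move=> k _ _; rewrite mule_ge0// lee_fin ltW.
  apply: leeD => //; rewrite /total_defect eseries_mkcond.
  by apply: lee_nneseries => [k _ _|k _]; case: ifP.
have : (nu N <= total_defect l n nu + ((l^-1)%:E * e%:E + e%:E))%E.
  have nn1 : (nu (N `+` W) <= e%:E)%E.
    by rewrite (le_trans _ (ltW rhoW))// leeDl.
  have nn2 : (m (W `&` B) <= e%:E)%E.
    by rewrite (le_trans mWB)// (le_trans _ (ltW rhoW))// leeDr.
  apply: (le_trans nuW); rewrite addeA; apply: leeD => //.
  apply: (le_trans key); apply: leeD => //; apply: lee_wpmul2l => //.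
  by rewrite lee_fin ltW.
rewrite -[X in (X <= _)%E](fineK finN) -EFinM -EFinD.
case: (total_defect l n nu) => [t||]; rewrite ?leey//.
rewrite -EFinD !lee_fin.
have -> : l^-1 * e + e = fine (nu N) / 2.
  by rewrite /e; field; rewrite !gt_eqF// ?addr_gt0// .
lra.
Qed.

End cells.

(** * Dyadic cubes *)

(** An integer separating [x] from [y] gives, when doubled, an integer separating [2 * x] from
    [2 * y]. This is why dyadic cubes refine each other. *)
Lemma floor_double_inj (R : realType) (x y : R) :
  Num.floor (2 * x) = Num.floor (2 * y) -> Num.floor x = Num.floor y.
Proof.
wlog xy : x y / Num.floor x < Num.floor y => [wl|] fxy.
  have [/wl->//|/wl h|//] := ltgtP (Num.floor x) (Num.floor y).
  by rewrite h.
have x1 : x < (Num.floor y)%:~R by rewrite -floor_lt_int.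
have y1 : (Num.floor y)%:~R <= y by rewrite -floor_ge_int.
have : Num.floor (2 * x) < 2 * Num.floor y.
  by rewrite floor_lt_int rmorphM/= ltr_pM2l.
have : 2 * Num.floor y <= Num.floor (2 * y).
  by rewrite floor_ge_int rmorphM/= ler_pM2l.
by rewrite fxy => /le_lt_trans/[apply]; rewrite ltxx.
Qed.

Section dyadic_cells.
Context (R : realType) (d : nat).
Local Notation T := 'rV[R]_d.

(* The label of the half-open dyadic cube of side [2^-n] containing [x], encoded
   as a natural number; labels that encode no cube have an empty cell. *)
Definition dyadic (n : nat) (x : T) : nat :=
  pickle (map_mx (fun r => Num.floor (2 ^+ n * r)) x : 'rV[int]_d).

Lemma eq_dyadic n (x y : T) : dyadic n x = dyadic n y <->
  forall j, Num.floor (2 ^+ n * x ord0 j) = Num.floor (2 ^+ n * y ord0 j).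
Proof.
split=> [/(pcan_inj pickleK)/matrixP e j|e].
  by have := e ord0 j; rewrite !mxE.
by congr pickle; apply/rowP => j; rewrite !mxE.
Qed.

Lemma dyadic_refine n (x y : T) :
  dyadic n.+1 x = dyadic n.+1 y -> dyadic n x = dyadic n y.
Proof.
rewrite !eq_dyadic => e j; apply: floor_double_inj.
by rewrite !mulrA -!exprS.
Qed.

Lemma dyadic_cellP n k : cell dyadic n k = set0 \/
  exists q : 'rV[int]_d, cell dyadic n k =
    [set x | forall j, (q ord0 j)%:~R / 2 ^+ n <= x ord0 j < (q ord0 j + 1)%:~R / 2 ^+ n].
Proof.
have [->|/set0P[x xk]] := eqVneq (cell dyadic n k) set0; [by left|right].
have p0 : (0 : R) < 2 ^+ n by rewrite exprn_gt0.
exists (map_mx (fun r => Num.floor (2 ^+ n * r)) x).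
apply/seteqP; split=> [y|y /= yq].
  rewrite /cell/= -xk => /eq_dyadic yx j; rewrite !mxE -yx.
  by rewrite ler_pdivrMr// ltr_pdivlMr// [y ord0 j * _]mulrC floor_itv.
rewrite /cell/= -xk; apply/eq_dyadic => j.
have := yq j; rewrite !mxE ler_pdivrMr// ltr_pdivlMr// [y ord0 j * _]mulrC.
exact: floor_def.
Qed.

Lemma measurable_box (a b : T) :
  measurable [set x : T | forall j, a ord0 j <= x ord0 j < b ord0 j].
Proof.
rewrite [X in measurable X](_ : _ = \bigcap_(j in [set: 'I_d])
    ((fun x : T => x ord0 j) @^-1` `[a ord0 j, b ord0 j[)); last first.
  apply/seteqP; split=> x /= h j; last by have := h j I; rewrite /= in_itv.
  by move=> _; rewrite /= in_itv/=; exact: h.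
apply: fin_bigcap_measurable => // j _; rewrite -[X in measurable X]setTI.
exact: measurable_mx_coord.
Qed.

Lemma measurable_dyadic_cell n k : measurable (cell dyadic n k).
Proof.
have [->//|[q ->]] := dyadic_cellP n k.
have := measurable_box (map_mx (fun z => z%:~R / 2 ^+ n) q)
  (map_mx (fun z => (z + 1)%:~R / 2 ^+ n) q).
by under eq_set do under eq_forall do rewrite !mxE.
Qed.

Lemma lebesgue_dyadic_cell n k : (lebesgue_row R d (cell dyadic n k) < +oo)%E.
Proof.
have mc := measurable_dyadic_cell n k.
have [->|[q E]] := dyadic_cellP n k; first by rewrite measure0.
pose a : T := map_mx (fun z => z%:~R / 2 ^+ n) q.
pose b : T := map_mx (fun z => (z + 1)%:~R / 2 ^+ n) q.
have ab j : a ord0 j <= b ord0 j.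
  by rewrite !mxE ler_pM2r ?invr_gt0 ?exprn_gt0// ler_int lerDl.
apply: (@le_lt_trans _ _ (lebesgue_row R d
    [set x : T | forall j, x ord0 j \in `[a ord0 j, b ord0 j]])).
  apply: le_measure; rewrite ?inE//.
    rewrite [X in measurable X](_ : _ = \bigcap_(j in [set: 'I_d])
        ((fun x : T => x ord0 j) @^-1` `[a ord0 j, b ord0 j])).
      apply: fin_bigcap_measurable => // j _; rewrite -[X in measurable X]setTI.
      exact: measurable_mx_coord.
    by apply/seteqP; split=> x /= h j; [move=> _|]; exact: h.
  rewrite E => x /= xq j; rewrite in_itv/= !mxE.
  by have /andP[-> /ltW] := xq j.
by rewrite lebesgue_row_box// ltry.
Qed.

(** An open set is the union, over all levels, of the cubes that it contains, because points of one
    cube of level [n] are within 2^-n of each other in the sup norm. *)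
Lemma measurable_dyadic_generate :
  @measurable _ T `<=` <<s level_sets (dyadic : nat -> T -> nat) >>.
Proof.
apply: smallest_sub; first exact: smallest_sigma_algebra.
move=> U oU.
have -> : U = \bigcup_n (dyadic n @^-1` [set k | cell dyadic n k `<=` U]).
  apply/seteqP; split=> [x Ux|x [n _ /=]]; last exact.
  have /nbhs_ballP[e /= e0 eU] : nbhs x U by exact: open_nbhs_nbhs.
  have [n n1] : exists n : nat, (2 ^+ n)^-1 < e.
    have [n ne] := ltr_add_invr e0.
    exists n.+1; rewrite add0r in ne; apply: le_lt_trans ne.
    rewrite lef_pV2 ?posrE ?exprn_gt0// -natrX ler_nat.
    by rewrite ltnW// ltn_expl.
  exists n => //= y; rewrite /cell/= => /eq_dyadic yx; apply: eU.
  split=> // i j; rewrite (ord1 i) /ball /=.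
  have p0 : (0 : R) < 2 ^+ n by rewrite exprn_gt0.
  apply: lt_trans n1; rewrite -(ltr_pM2l p0) mulfV ?gt_eqF//.
  rewrite -{1}(gtr0_norm p0) -normrM mulrBr.
  have := floor_itv (2 ^+ n * x ord0 j); have := floor_itv (2 ^+ n * y ord0 j).
  rewrite yx rmorphD/=; set f := (_%:~R) => /andP[? ?] /andP[? ?].
  by rewrite ltr_norml; apply/andP; split; lra.
apply: sigma_algebra_bigcup => n; apply: sub_sigma_algebra.
by exists n, [set k | cell dyadic n k `<=` U].
Qed.

End dyadic_cells.

(* No measurability: it is applied to integrands built from [V], whose joint
   measurability would otherwise have to be established. *)
Lemma ge0_le_integral_nomeas d (T : measurableType d) (R : realType)
    (mu : {measure set T -> \bar R}) (D : set T) (f g : T -> \bar R) :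
  (forall x, D x -> 0 <= f x)%E -> (forall x, D x -> f x <= g x)%E ->
  (\int[mu]_(x in D) f x <= \int[mu]_(x in D) g x)%E.
Proof.
move=> f0 fg; have g0 x : D x -> (0 <= g x)%E.
  by move=> Dx; apply: le_trans (fg _ Dx); exact: f0.
rewrite (integral_mkcond D f) (integral_mkcond D g).
rewrite !ge0_integralTE//; [|exact: erestrict_ge0..].
apply: ereal_sup_le => _ [h hf <-]; exists h => // x.
by apply: (le_trans (hf x)); exact: lee_restrict.
Qed.

(** * The heat kernel and the heat semigroup *)

Section heat_kernel.
Context (R : realType).

(** Tonelli along the inductive construction of [lebesgue_row]; used to normalise the heat kernel, a
    product of one-dimensional normal densities. *)
Lemma integral_lebesgue_row_prod d (g : 'I_d -> R -> R) :
  (forall j, measurable_fun setT (g j)) -> (forall j x, 0 <= g j x) ->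
  (forall j, \int[lebesgue_measure]_x (g j x)%:E = 1)%E ->
  (\int[lebesgue_row R d]_x (\prod_j g j (x ord0 j))%:E = 1)%E.
Proof.
elim: d g => [|d IH] g mg g0 g1.
  rewrite (eq_integral (fun=> 1%E)); last by move=> x _; rewrite big_ord0.
  by rewrite integral_cst//= diracT mule1.
have mprod : measurable_fun setT (EFin \o (fun x : 'rV[R]_d.+1 => \prod_j g j (x ord0 j))).
  apply/measurable_EFinP; apply: measurable_prod => j _.
  apply: measurableT_comp => //; exact: measurable_mx_coord.
rewrite /= ge0_integral_pushforward//; last 2 first.
- exact: measurable_cons_row.
- by move=> x _; rewrite lee_fin prodr_ge0.
rewrite preimage_setT fubini_tonelli1//=; last 2 first.
- by apply: measurableT_comp => //; exact: measurable_cons_row.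
- by move=> x; rewrite lee_fin prodr_ge0.
rewrite -[RHS](g1 ord0); apply: eq_integral => x _; rewrite /fubini_F/=.
under eq_integral.
  move=> y _; rewrite big_ord_recl mxE unlift_none/= EFinM.
  under eq_bigr do rewrite mxE liftK/=.
  over.
rewrite ge0_integralZl//; last 3 first.
- apply/measurable_EFinP; apply: measurable_prod => j _.
  apply: measurableT_comp => //; exact: measurable_mx_coord.
- by move=> y _; rewrite lee_fin prodr_ge0.
- by rewrite lee_fin.
by rewrite (IH (fun j => g (lift ord0 j)))// mule1.
Qed.

Context (d : nat).
Implicit Types (t : R) (x y : 'rV[R]_d).

Lemma euclidean_norm_sqr x : euclidean_norm x ^+ 2 = \sum_j x ord0 j ^+ 2.
Proof. by rewrite sqr_sqrtr//; apply: sumr_ge0 => j _; exact: sqr_ge0. Qed.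

Lemma heat_kernel_ge0 t x : 0 <= heat_kernel t x.
Proof. by rewrite mulr_ge0 ?powR_ge0 ?expR_ge0. Qed.

Lemma heat_kernel_ub t x : 0 < t ->
  heat_kernel t x <= (2 * pi * t) `^ (- (d%:R / 2)).
Proof.
move=> t0; apply: ler_piMr; first exact: powR_ge0.
by rewrite -expR0 ler_expR oppr_le0 divr_ge0 ?sqr_ge0// mulr_ge0// ltW.
Qed.

Lemma heat_kernel_prod t x y : 0 < t ->
  heat_kernel t (x - y) = \prod_j normal_pdf (x ord0 j) (Num.sqrt t) (y ord0 j).
Proof.
move=> t0; have s0 : Num.sqrt t != 0 by rewrite gt_eqF// sqrtr_gt0.
have pt0 : 0 < 2 * pi * t by rewrite !mulr_gt0// pi_gt0.
under eq_bigr do rewrite normal_pdfE//.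
rewrite big_split/= prodr_const card_ord /heat_kernel; congr (_ * _).
  rewrite /normal_peak sqr_sqrtr ?ltW// -powR12_sqrt; last first.
    by rewrite mulrn_wge0// mulr_ge0 ?pi_ge0// ltW.
  rewrite -powRN -powR_mulrn ?powR_ge0// -powRrM.
  congr (_ `^ _); last by field.
  by rewrite -mulr_natr; ring.
rewrite /normal_fun -expR_sum; congr expR.
rewrite euclidean_norm_sqr sqr_sqrtr ?ltW// -mulNr -sumrN mulr_suml; apply: eq_bigr => j _.
by rewrite !mxE !mulNr mulr_natl -[(x _ _ - _) ^+ 2]sqrrN opprB.
Qed.

Lemma integral_heat_kernel t x : 0 < t ->
  (\int[lebesgue_row R d]_y (heat_kernel t (x - y))%:E = 1)%E.
Proof.
move=> t0; under eq_integral do rewrite heat_kernel_prod//.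
apply: (@integral_lebesgue_row_prod _ (fun j => normal_pdf (x ord0 j) (Num.sqrt t))).
- by move=> j; exact: measurable_normal_pdf.
- by move=> j r; exact: normal_pdf_ge0.
- by move=> j; rewrite integral_normal_pdf// gt_eqF// sqrtr_gt0.
Qed.

Lemma measurable_heat_kernel t : 0 < t ->
  measurable_fun setT (fun z : 'rV[R]_d * 'rV[R]_d => heat_kernel t (z.1 - z.2)).
Proof.
move=> t0.
have mc (p : 'rV[R]_d * 'rV[R]_d -> 'rV[R]_d) j : measurable_fun setT p ->
    measurable_fun setT (fun z => p z ord0 j).
  by move=> mp; exact: (measurableT_comp (measurable_mx_coord ord0 j) mp).
have mn : measurable_fun setT (fun z : 'rV[R]_d * 'rV[R]_d =>
    euclidean_norm (z.1 - z.2) ^+ 2).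
  under eq_fun do rewrite euclidean_norm_sqr.
  apply: measurable_sum => j; apply: measurable_funX.
  under eq_fun do rewrite !mxE.
  by apply: measurable_funB; apply: mc; [exact: measurable_fst|exact: measurable_snd].
apply: measurable_funM => //.
have mq := measurable_funM mn (measurable_cst (2 * t)^-1).
have m2 := measurableT_comp (@oppr_measurable R setT) mq.
have m3 := measurableT_comp (@measurable_expR R) m2.
exact: m3.
Qed.

(** S_t 1_A(x), the probability that a Brownian motion started at [x] is in [A] at time [t]. *)
Definition heat_mass t (A : set 'rV[R]_d) x : \bar R :=
  (\int[lebesgue_row R d]_(y in A) (heat_kernel t (x - y))%:E)%E.

Lemma measurable_heat_kernelr t x : 0 < t ->
  measurable_fun setT (fun y : 'rV[R]_d => heat_kernel t (x - y)).
Proof.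
by move=> t0; exact: (measurableT_comp (measurable_heat_kernel t0) (pair1_measurable x)).
Qed.

Lemma heat_mass_ge0 t A x : (0 <= heat_mass t A x)%E.
Proof. by apply: integral_ge0 => y _; rewrite lee_fin heat_kernel_ge0. Qed.

Lemma heat_mass_ub t A x : 0 < t -> measurable A ->
  (heat_mass t A x <= ((2 * pi * t) `^ (- (d%:R / 2)))%:E * lebesgue_row R d A)%E.
Proof.
move=> t0 mA; rewrite -integral_cst//; apply: ge0_le_integral => //.
- by move=> y _; rewrite lee_fin heat_kernel_ge0.
- apply/measurable_EFinP; apply: measurable_funTS; exact: measurable_heat_kernelr.
- by move=> y _; rewrite lee_fin heat_kernel_ub.
Qed.

Lemma measurable_heat_mass t A : 0 < t -> measurable A ->
  measurable_fun setT (heat_mass t A).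
Proof.
move=> t0 mA.
pose f (z : 'rV[R]_d * 'rV[R]_d) : \bar R :=
  (heat_kernel t (z.1 - z.2) * \1_A z.2)%:E.
have -> : heat_mass t A = fubini_F (lebesgue_row R d) f.
  apply/funext => x; rewrite /heat_mass /fubini_F [LHS]integral_mkcond.
  apply: eq_integral => y _; rewrite /f/= patchE indicE.
  by case: ifP => _; rewrite ?mulr1 ?mulr0.
apply: measurable_fun_fubini_tonelli_F => [|z].
  apply/measurable_EFinP; apply: measurable_funM; first exact: measurable_heat_kernel.
  exact: (measurableT_comp (measurable_indic _) measurable_snd).
by rewrite lee_fin mulr_ge0// heat_kernel_ge0.
Qed.

Lemma heat_mass_cells (c : nat -> 'rV[R]_d -> nat) n t x : 0 < t ->
  (forall k, measurable (cell c n k)) ->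
  (\sum_(k <oo) heat_mass t (cell c n k) x = 1)%E.
Proof.
move=> t0 mc; rewrite -(integral_heat_kernel x t0) -(preimage_setT (c n)).
rewrite level_bigcup ge0_integral_bigcup//.
- apply/measurable_EFinP; apply: measurable_funTS; exact: measurable_heat_kernelr.
- by move=> y _; rewrite lee_fin heat_kernel_ge0.
- exact: trivIset_cell.
Qed.

Lemma heat_semigroup_affine t a b A x : 0 < t -> 0 <= a -> 0 <= b -> measurable A ->
  heat_semigroup t (fun y => a + b * \1_A y) x = (a%:E + b%:E * heat_mass t A x)%E.
Proof.
move=> t0 a0 b0 mA; rewrite /heat_semigroup.
have mk := measurable_heat_kernelr x t0.
transitivity (\int[lebesgue_row R d]_y (a%:E * (heat_kernel t (x - y))%:E +
    b%:E * (heat_kernel t (x - y) * \1_A y)%:E))%E.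
  by apply: eq_integral => y _; rewrite -!EFinM -EFinD; congr EFin; ring.
have mkA : measurable_fun setT (EFin \o (fun y => heat_kernel t (x - y) * \1_A y)).
  apply/measurable_EFinP; apply: measurable_funM => //; exact: measurable_indic.
rewrite ge0_integralD//; last 4 first.
- by move=> y _; rewrite -EFinM lee_fin mulr_ge0// heat_kernel_ge0.
- by apply: measurable_funeM; exact/measurable_EFinP.
- by move=> y _; rewrite -EFinM lee_fin mulr_ge0// mulr_ge0// heat_kernel_ge0.
- exact: measurable_funeM.
rewrite !ge0_integralZl//; last 3 first. 
- by move=> y _; rewrite lee_fin mulr_ge0// heat_kernel_ge0.
- exact/measurable_EFinP.
- by move=> y _; rewrite lee_fin heat_kernel_ge0.
rewrite integral_heat_kernel// mule1; congr (_ + _ * _)%E.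
rewrite /heat_mass [RHS]integral_mkcond; apply: eq_integral => y _.
by rewrite patchE indicE; case: ifP => _; rewrite ?mulr1 ?mulr0.
Qed.

Lemma heat_semigroup_cst t a x : 0 < t -> 0 <= a ->
  heat_semigroup t (cst a) x = a%:E.
Proof.
move=> t0 a0; rewrite -[RHS]adde0 -[in RHS](mul0e (heat_mass t set0 x)).
rewrite -(@heat_semigroup_affine t a 0 set0)//.
by congr heat_semigroup; apply/funext => y; rewrite mul0r addr0.
Qed.

End heat_kernel.

(** * The log-Laplace equation with data constant in space *)

Section constant_solution.
Context (R : realType) (gamma theta : R).
Hypotheses (gamma_lt1 : gamma < 1) (theta_gt0 : 0 < theta).

Let u (t : R) : R := theta `^ (1 - gamma) + (1 - gamma) * t.
Let p : R := (1 - gamma)^-1.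

(** For constant data the equation reduces to v' = v^gamma, v(0) = theta, along which v^(1-gamma)
    grows linearly. *)
Definition const_solution (t : R) : R := u t `^ p.

Let g1_gt0 : 0 < 1 - gamma. Proof. by rewrite subr_gt0. Qed.

Let p_gt0 : 0 < p. Proof. by rewrite invr_gt0. Qed.

Let u_gt0 (t : R) : 0 <= t -> 0 < u t.
Proof.
by move=> t0; rewrite ltr_pwDl ?powR_gt0// mulr_ge0// ltW.
Qed.

Lemma const_solution0 : const_solution 0 = theta.
Proof.
by rewrite /const_solution /u mulr0 addr0 -powRrM mulfV ?gt_eqF// powRr1// ltW.
Qed.

Lemma const_solution_gt0 (t : R) : 0 <= t -> 0 < const_solution t.
Proof. by move=> t0; rewrite powR_gt0 ?u_gt0. Qed.

Lemma le_const_solution (s t : R) : 0 <= s -> s <= t -> const_solution s <= const_solution t.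
Proof.
move=> s0 st; have t0 := le_trans s0 st.
apply: ge0_ler_powR; rewrite ?nnegrE; [exact: ltW|exact/ltW/u_gt0..|].
by rewrite lerD2l ler_pM2l.
Qed.

Lemma ge_const_solution (t : R) : 0 <= t -> theta <= const_solution t.
Proof. by move=> t0; rewrite -[leLHS]const_solution0 le_const_solution. Qed.

Let is_derive_powR_u (r t : R) : 0 <= t ->
  is_derive t 1 (fun s => u s `^ r) (r * u t `^ (r - 1) * (1 - gamma)).
Proof.
move=> t0; apply: (@is_derive1_comp _ (fun x => x `^ r) u).
  exact: is_derive1_powR (u_gt0 t0).
rewrite -[X in is_derive _ _ _ X]add0r -[X in is_derive _ _ _ (_ + X)]mulr1.
by apply: is_deriveD.
Qed.

Let continuous_powR_u (r t : R) : 0 <= t -> {for t, continuous (fun s => u s `^ r)}.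
Proof.
move=> t0; apply: differentiable_continuous; apply/derivable1_diffP.
by have [] := is_derive_powR_u r t0.
Qed.

Lemma continuous_const_solution (t : R) : 0 <= t -> {for t, continuous const_solution}.
Proof. exact: continuous_powR_u. Qed.

(** Fundamental theorem of calculus: as [p * (1 - gamma) = 1], the derivative of u^p is u^(p-1), and
    [p - 1 = p * gamma]. *)
Lemma integral_const_solution (t : R) : 0 < t ->
  (\int[lebesgue_measure]_(s in `]0%R, t[) (const_solution s `^ gamma)%:E =
   (const_solution t - theta)%:E)%E.
Proof.
move=> t0.
have fE s : const_solution s `^ gamma = u s `^ (p * gamma) by rewrite powRrM.
under eq_integral do rewrite fE.
have cw : {within `[0, t], continuous (fun s => u s `^ (p * gamma))}.
  apply: continuous_in_subspaceT => s; rewrite inE/= in_itv/= => /andP[s0 _].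
  exact: continuous_powR_u.
rewrite -(@integral_itv_bndoo _ _ _ _ true false); last first.
  apply/measurable_EFinP.
  apply: (@measurable_funS _ _ _ _ `[0, t]%classic) => //.
    exact: subset_itv_oo_cc.
  exact: subspace_continuous_measurable_fun.
rewrite (@continuous_FTC2 _ _ const_solution)//.
- by rewrite const_solution0.
- split.
  + move=> s; rewrite in_itv/= => /andP[/ltW s0 _].
    by have [] := is_derive_powR_u p s0.
  + exact/cvg_at_right_filter/continuous_const_solution.
  + by apply/cvg_at_left_filter/continuous_const_solution; exact: ltW.
- move=> s; rewrite in_itv/= => /andP[/ltW s0 _].
  have := is_derive_powR_u p s0.
  rewrite derive1E => /@derive_val ->.
  have -> : p * gamma = p - 1 by rewrite /p; field; rewrite gt_eqF.
  by rewrite mulrAC mulVf ?gt_eqF// mul1r.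
Qed.

End constant_solution.

Lemma const_solution_homo (R : realType) (gamma a b t : R) : gamma < 1 ->
  0 < a -> a <= b -> 0 <= t -> const_solution gamma a t <= const_solution gamma b t.
Proof.
move=> g1 a0 ab t0; have b0 := lt_le_trans a0 ab.
have g10 : 0 < 1 - gamma by rewrite subr_gt0.
have s0 : 0 <= (1 - gamma) * t by rewrite mulr_ge0// ltW.
apply: ge0_ler_powR; rewrite ?nnegrE.
- by rewrite invr_ge0 ltW.
- by rewrite addr_ge0 ?powR_ge0.
- by rewrite addr_ge0 ?powR_ge0.
by rewrite lerD2r; apply: ge0_ler_powR; rewrite ?nnegrE// ltW.
Qed.


(** * Test functions and the value of the log-Laplace semigroup at constants *)

Section constant_log_laplace.
Context (R : realType) (d : nat).
Local Notation T := 'rV[R]_d.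

Lemma lebesgue_row_gt0 : (0 < lebesgue_row R d setT)%E.
Proof.
pose a : T := const_mx 0; pose b : T := const_mx 1.
have ab j : a ord0 j <= b ord0 j by rewrite !mxE.
apply: (@lt_le_trans _ _ (lebesgue_row R d
    [set x : T | forall j, x ord0 j \in `[a ord0 j, b ord0 j]])).
  rewrite lebesgue_row_box// lte_fin.
  by apply: prodr_gt0 => j _; rewrite !mxE subr0.
apply: le_measure; rewrite ?inE//.
rewrite [X in measurable X](_ : _ = \bigcap_(j in [set: 'I_d])
    ((fun x : T => x ord0 j) @^-1` `[a ord0 j, b ord0 j])).
  apply: fin_bigcap_measurable => // j _; rewrite -[X in measurable X]setTI.
  exact: measurable_mx_coord.
by apply/seteqP; split=> x /= h j; [move=> _|]; exact: h.
Qed.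

(** Laplace functionals are evaluated only at these functions and at constants. The positive [a]
    keeps them from vanishing almost everywhere. *)
Lemma test_function_affine (a b : R) (A : set T) : 0 < a -> 0 <= b ->
  measurable A -> test_function (fun y => a + b * \1_A y).
Proof.
move=> a0 b0 mA.
have ge_a x : a <= a + b * \1_A x by rewrite lerDl mulr_ge0.
split.
- apply: measurable_funD => //.
  have mI : measurable_fun setT (\1_A : T -> R) by exact: measurable_indic.
  have mbI := measurable_funM (measurable_cst b) mI.
  exact: mbI.
- by move=> x; rewrite (le_trans _ (ge_a x))// ltW.
- by exists (a + b) => x; rewrite lerD2l ler_piMr.
- case=> N [mN N0 sN]; have := lebesgue_row_gt0.
  rewrite (_ : setT = N) ?N0 ?ltxx//; apply/esym; rewrite -subTset => x _.
  by apply: sN => /=; apply/eqP; rewrite gt_eqF// (lt_le_trans a0).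
Qed.

Lemma test_function_cst (a : R) : 0 < a -> test_function (cst a : T -> R).
Proof.
move=> a0; have := @test_function_affine a 0 set0 a0 (lexx 0) measurable0.
by congr test_function; apply/funext => y; rewrite mul0r addr0.
Qed.

Context (gamma : R) (V : R -> (T -> R) -> T -> R).
Hypothesis gamma_lt1 : gamma < 1.
Hypothesis VP : log_laplace_semigroup gamma V.

Lemma log_laplace_solution_cst (theta : R) : 0 < theta ->
  log_laplace_solution gamma (cst theta) (fun t (_ : T) => const_solution gamma theta t).
Proof.
move=> th0; split.
- by move=> t x t0; rewrite ltW// const_solution_gt0// ltW.
- apply: continuous_in_subspaceT => z; rewrite inE/= => z0.
  apply: (@continuous_comp _ _ _ fst (const_solution gamma theta)).
    exact: cvg_fst.
  by apply: continuous_const_solution => //; exact: ltW.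
(* The normalising constant of the weight is borrowed from the solution with datum 1, which avoids
   integrating e^{-|x|}. *)
- have [+ _] := VP (test_function_cst (@ltr01 R)).
  case=> _ _ [C C1 _] _; exists C => // a b a0 ab.
  exists (`|C| * const_solution gamma theta b).
  apply: aeW => /= t; rewrite in_itv/= => /andP[at1 tb].
  have t0 := lt_le_trans a0 at1.
  apply: ess_sup_ler => x; rewrite lee_fin normrM.
  apply: ler_pM => //.
    rewrite normrM [X in _ * X]ger0_norm ?expR_ge0// ler_piMr// -expR0 ler_expR oppr_le0.
    exact: sqrtr_ge0.
  rewrite ger0_norm ?le_const_solution//; first exact: ltW.
  by rewrite ltW// const_solution_gt0// ltW.
- move=> t x t0; rewrite heat_semigroup_cst//; last exact: ltW.
  transitivity (theta%:E + (const_solution gamma theta t - theta)%:E)%E.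
    by rewrite -EFinD subrKC.
  rewrite -integral_const_solution//; congr (_ + _)%E.
  apply: eq_integral => s; rewrite inE/= in_itv/= => /andP[s0 st].
  by rewrite heat_semigroup_cst ?subr_gt0// powR_ge0.
Qed.

Lemma log_laplace_cst (theta t : R) (x : T) : 0 < theta -> 0 < t ->
  V t (cst theta) x = const_solution gamma theta t.
Proof.
move=> th0 t0; have [_ VU] := VP (test_function_cst th0).
exact: (esym (VU _ (log_laplace_solution_cst th0) t x t0)).
Qed.

End constant_log_laplace.

(** * Measurable functionals of a random measure *)

(** The value is 0 where [f] is infinite, so the function is a real exponential times the indicator
    of the set where [f] is finite. *)
Lemma measurable_expeRN d (T : measurableType d) (R : realType) (f : T -> \bar R) :
  measurable_fun setT f -> (forall x, 0 <= f x)%E ->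
  measurable_fun setT (fun x => expeR (- f x)%E).
Proof.
move=> mf f0.
have mA : measurable (f @^-1` [set +oo%E]).
  by rewrite -[X in measurable X]setTI; exact: mf.
have -> : (fun x => expeR (- f x)%E) =
    EFin \o ((expR \o -%R \o fine \o f) \* \1_(~` (f @^-1` [set +oo%E]))).
  apply/funext => x /=; rewrite indicE; have := f0 x.
  case E : (f x) => [r||]// _ /=.
    by rewrite mem_set ?mulr1//= E.
  by rewrite memNset ?mulr0//= => /(_ E).
apply/measurable_EFinP; apply: measurable_funM.
  have m1 := measurableT_comp (@fine_measurable R setT measurableT) mf.
  have m2 := measurableT_comp (@oppr_measurable R setT) m1.
  exact: (measurableT_comp (@measurable_expR R) m2).
by apply: measurable_indic; exact: measurableC.
Qed.

Section measure_space_functionals.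
Context d (T : measurableType d) (R : realType).
Local Notation state := (measure_space T R).

Lemma measurable_measure_space_eval (A : set T) : measurable A ->
  measurable_fun [set: state] (fun eta : state => eta A).
Proof.
move=> mA; apply: (@measurability _ _ state _ setT
    (fun eta : state => eta A) measurable).
  by rewrite smallest_id//; exact: sigma_algebra_measurable.
apply: subset_trans; last exact: sub_gen_smallest.
exact: (bigcup_sup mA).
Qed.

Lemma measurable_defect (l q : R) (A : set T) : measurable A ->
  measurable_fun [set: state] (fun eta : state => (defect l q (fine (eta A)))%:E).
Proof.
move=> mA; apply/measurable_EFinP.
have mf : measurable_fun [set: state] (fun eta : state => fine (eta A)).
  exact: (measurableT_comp (@fine_measurable R setT measurableT)
    (measurable_measure_space_eval mA)).
apply: measurable_funB => //; apply: measurable_funM => //.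
apply: measurable_funB => //.
have m1 := measurable_funM (measurable_cst l) mf.
have m2 := measurable_funM m1 (measurable_cst q^-1).
have m3 := measurableT_comp (@oppr_measurable R setT) m2.
have m4 := measurableT_comp (@measurable_expR R) m3.
exact: m4.
Qed.

Lemma measurable_total_defect (m : {measure set T -> \bar R}) (c : nat -> T -> nat) l n :
  0 < l -> (forall k, measurable (cell c n k)) ->
  measurable_fun [set: state] (fun eta : state => total_defect m c l n eta).
Proof.
move=> l0 mc; apply: ge0_emeasurable_sum => [k eta _ _|k _].
  by rewrite lee_fin defect_ge0// fine_ge0.
exact: measurable_defect.
Qed.

End measure_space_functionals.

(** * Elementary inequalities and the choice of parameters *)

Section real_estimates.
Context (R : realType).
Implicit Types (l q x y a e N : R).

(** Expresses the damped defect through exponentials that are Laplace functionals of masses. There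
    are no subtractions between terms, so the identity can be integrated in the extended reals. *)
Lemma defect_balance l q x y :
  expR (- x) * defect l q y + q / l * expR (- x) =
  expR (- x) * y + q / l * expR (- (x + l / q * y)).
Proof.
rewrite opprD expRD /defect (_ : l * y / q = l / q * y); first by ring.
by rewrite mulrAC.
Qed.

(** Factor e^{-ax} = e^{-x} e^{(1-a)x} and bound the second exponential below by its tangent at
    0. *)
Lemma damping_convex a x : (1 - a) * (expR (- x) * x) + expR (- x) <= expR (- (a * x)).
Proof.
have -> : - (a * x) = - x + (1 - a) * x by ring.
rewrite expRD; have := expR_ge1Dx ((1 - a) * x).
rewrite -(ler_pM2l (expR_gt0 (- x))); apply: le_trans.
by rewrite le_eqVlt; apply/orP; left; apply/eqP; ring.
Qed.

Lemma onem_expR_ge x : 0 <= x -> x - x ^+ 2 <= 1 - expR (- x).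
Proof.
move=> x0; have x1 : 0 < 1 + x by rewrite ltr_pwDl.
have : expR (- x) <= (1 + x)^-1.
  by rewrite expRN lef_pV2 ?posrE ?expR_gt0// expR_ge1Dx.
suff : (1 + x)^-1 <= 1 - x + x ^+ 2 by lra.
rewrite -(ler_pM2l x1) mulfV ?gt_eqF//.
have -> : (1 + x) * (1 - x + x ^+ 2) = 1 + x ^+ 3 by ring.
by rewrite lerDl exprn_ge0.
Qed.

Lemma mass_damping N : 0 <= N -> N * expR (- (N / 2)) <= 2.
Proof.
move=> N0; rewrite expRN ler_pdivrMr ?expR_gt0//.
have := expR_ge1Dx (N / 2); lra.
Qed.

(** [mass_damping] at [N / 2], squared and multiplied by 4. Both bounds serve to make the final
    estimate uniform in the initial mass. *)
Lemma mass_damping2 N : 0 <= N -> N ^+ 2 * expR (- (N / 2)) <= 16.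
Proof.
move=> N0; have /mass_damping h : 0 <= N / 2 by rewrite divr_ge0.
have -> : N ^+ 2 * expR (- (N / 2)) = 4 * (N / 2 * expR (- (N / 2 / 2))) ^+ 2.
  have <- : expR (- (N / 2 / 2)) ^+ 2 = expR (- (N / 2)).
    by rewrite -expRM_natl; congr expR; field.
  by field.
have h0 : 0 <= N / 2 * expR (- (N / 2 / 2)) by rewrite mulr_ge0 ?divr_ge0 ?expR_ge0.
have : (N / 2 * expR (- (N / 2 / 2))) ^+ 2 <= 2 ^+ 2 by rewrite ler_pXn2r ?nnegrE.
lra.
Qed.

(** Here [N] is the initial mass, [va] and [v1] are v_a(t) and v_1(t), [U] is the damped total mass
    and [W] the damped total defect. The constant is 16 + 2 + 16: [16 * e] for replacing [Ea] by
    [E1], [2 * e] for the excess slope, and [16 * e] for the quadratic error. *)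
Lemma defect_estimate (a e va v1 N U W lC : R) :
  0 <= N -> 0 <= e -> a < 1 -> 2^-1 <= va -> va <= v1 ->
  v1 - va <= (1 + e) * (1 - a) -> v1 - va <= e -> 0 <= lC -> lC <= e ->
  (1 - a) * U + expR (- (v1 * N)) <= expR (- (va * N)) ->
  W + expR (- (v1 * N)) * N <= U + expR (- (v1 * N)) * (lC * N ^+ 2) ->
  W <= 34 * e.
Proof.
move=> N0 e0 a1 va2 v1a slope gap lC0 lCe HU HW.
set E1 := expR (- (v1 * N)) in HU HW; set Ea := expR (- (va * N)) in HU.
have Ea0 : 0 < Ea by exact: expR_gt0.
have E1a : E1 <= Ea by rewrite ler_expR lerN2 ler_wpM2r.
have EaH : Ea <= expR (- (N / 2)).
  by rewrite ler_expR lerN2 mulrC; apply: ler_wpM2r.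
have diff : Ea - E1 <= Ea * ((v1 - va) * N).
  have -> : E1 = Ea * expR (- ((v1 - va) * N)).
    by rewrite -expRD; congr expR; ring.
  have := expR_ge1Dx (- ((v1 - va) * N)).
  rewrite -(ler_pM2l Ea0); set w := expR _; lra.
have b1 : N * Ea <= 2.
  by rewrite (le_trans _ (mass_damping N0))// ler_wpM2l.
have b2 : N ^+ 2 * Ea <= 16.
  by rewrite (le_trans _ (mass_damping2 N0))// ler_wpM2l// sqr_ge0.
have a10 : 0 < 1 - a by lra.
(* The factor [1 - a] in [HU] cancels against the one in the slope bound. *)
have U1 : U <= (1 + e) * (N * Ea).
  rewrite -(ler_pM2l a10); apply: (@le_trans _ _ (Ea * ((v1 - va) * N))); first by lra.
  have -> : (1 - a) * ((1 + e) * (N * Ea)) = Ea * (((1 + e) * (1 - a)) * N) by ring.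
  by rewrite ler_pM2l// ler_wpM2r.
have c1 : N * (Ea - E1) <= e * (N ^+ 2 * Ea).
  apply: (@le_trans _ _ (N * (Ea * ((v1 - va) * N)))); first by rewrite ler_wpM2l.
  have -> : N * (Ea * ((v1 - va) * N)) = (v1 - va) * (N ^+ 2 * Ea) by ring.
  by rewrite ler_wpM2r// mulr_ge0 ?sqr_ge0// ltW.
have c2 : E1 * (lC * N ^+ 2) <= e * (N ^+ 2 * Ea).
  have -> : E1 * (lC * N ^+ 2) = lC * (N ^+ 2 * E1) by ring.
  by rewrite ler_pM// ?mulr_ge0 ?sqr_ge0 ?expR_ge0// ler_wpM2l// sqr_ge0.
have d1 : e * (N * Ea) <= e * 2 by rewrite ler_wpM2l.
have d2 : e * (N ^+ 2 * Ea) <= e * 16 by rewrite ler_wpM2l.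
move: U1 c1 c2 HW d1 d2 => {HU b1 b2}; lra.
Qed.

End real_estimates.

(** At time 0 the two solutions differ by exactly [1 - a], so continuity gives the slope bound for
    small [delta], with [a] fixed first. The choice [a = 1 - e / 2] makes [(1 + e) * (1 - a)] at
    most [e] because [e <= 1]. *)
Lemma small_parameters (R : realType) (gamma e t : R) :
  0 < gamma -> gamma < 1 -> 0 < e -> e <= 1 -> 0 < t ->
  exists a delta : R, [/\ 2^-1 <= a, a < 1, 0 < delta, delta <= t &
    const_solution gamma 1 delta - const_solution gamma a delta <= (1 + e) * (1 - a) <= e].
Proof.
move=> g0 g1 e0 e1 t0; pose a : R := 1 - e / 2.
have a0 : 0 < a by rewrite /a; lra.
pose f s := const_solution gamma 1 s - const_solution gamma a s.
have cf : {for 0, continuous f}.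
  by apply: cvgB; apply: continuous_const_solution.
have f0 : f 0 = 1 - a by rewrite /f !const_solution0.
have e2 : 0 < e * (1 - a) by rewrite mulr_gt0// /a; lra.
have /cvgrPdist_le/(_ _ e2)/nbhs_ballP[r /= r0 br] := cf.
pose delta := Num.min t (r / 2).
have d0 : 0 < delta by rewrite lt_min t0 divr_gt0.
have dr : delta < r.
  by rewrite (@le_lt_trans _ _ (r / 2)) ?ge_min ?lexx ?orbT//; lra.
exists a, delta; split=> //.
- by rewrite /a; lra.
- by rewrite /a; lra.
- by rewrite ge_min lexx.
apply/andP; split.
  have : `|f 0 - f delta| <= e * (1 - a).
    by apply: br; rewrite /ball/= sub0r normrN gtr0_norm.
  rewrite f0 distrC => /ler_normlP[_].
  by rewrite lerBlDr => /le_trans; apply; rewrite mulrDl mul1r addrC.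
have -> : 1 - a = e / 2 by rewrite /a; ring.
have : e * e <= e * 1 by rewrite ler_pM2l.
lra.
Qed.

(** * Lower bound for the log-Laplace semigroup *)

Section transition_estimate.
Context (R : realType) (d : nat) (gamma : R).
Local Notation T := 'rV[R]_d.
Local Notation state := (measure_space 'rV[R]_d R).
Context (V : R -> (T -> R) -> T -> R) (Q : R -> R.-pker state ~> state).
Hypotheses (gamma_gt0 : 0 < gamma) (gamma_lt1 : gamma < 1).
Hypothesis VP : log_laplace_semigroup gamma V.
Hypothesis QP : log_laplace_transition V Q.

Lemma measurable_log_laplace (t : R) f : 0 < t -> test_function f ->
  measurable_fun setT (V t f).
Proof.
move=> t0 tf; have [[_ cV _ _] _] := VP tf.
have oA : open [set z : R * T | 0 < z.1].
  by apply: (@open_comp _ _ fst [set x : R | 0 < x]) => [z _|];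
    [exact: cvg_fst|exact: open_gt].
have cVt : continuous (V t f).
  rewrite continuous_open_subspace// in cV.
  move=> x; have cVx : {for (t, x), continuous (fun z : R * T => V z.1 f z.2)}.
    by apply: cV; rewrite inE.
  have ct : {for x, continuous (fun y : T => (t, y))}.
    move=> A [[U W] [/= Ut Wx] UWA]; apply: filterS Wx => y Wy.
    by apply: (UWA (t, y)); split=> //; exact: nbhs_singleton.
  exact: (continuous_comp ct cVx).
apply: (measurability _ (RGenOpens.measurableE R)).
move=> _ [_ [a [b ->]] <-]; rewrite setTI; apply: open_mx_measurable.
by apply: open_comp => [A _|]; [exact: cVt|exact: interval_open].
Qed.

Lemma integral_affine_state (eta : state) (a b : R) (A : set T) :
  0 <= a -> 0 <= b -> measurable A ->
  (\int[eta]_x (a + b * \1_A x)%:E = a%:E * eta setT + b%:E * eta A)%E.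
Proof.
move=> a0 b0 mA.
have mI : measurable_fun setT (EFin \o (\1_A : T -> R)).
  by apply/measurable_EFinP; exact: measurable_indic.
under eq_integral do rewrite EFinD EFinM.
rewrite ge0_integralD//; last 2 first.
- by move=> x _; rewrite mule_ge0// lee_fin.
- exact: measurable_funeM.
rewrite integral_cst// ge0_integralZl//.
by rewrite integral_indic// setIT.
Qed.

(** Monotonicity is read off the process rather than the integral equation: started from the Dirac
    mass at [x], its Laplace functional is e^{-V_s f(x)}, which decreases as [f] grows. *)
Lemma log_laplace_mono (s a b : R) (A : set T) x : 0 < s -> 0 < a -> 0 <= b ->
  measurable A -> V s (cst a) x <= V s (fun y => a + b * \1_A y) x.
Proof.
move=> s0 a0 b0 mA.
have tf := test_function_affine a0 b0 mA.
have tc := test_function_cst d a0.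
rewrite -lee_fin -leeN2 -lee_expeR.
have dirac_V g : test_function g -> (\int[\d_x]_y (V s g y)%:E = (V s g x)%:E)%E.
  move=> tg; rewrite integral_dirac//; last first.
    by apply/measurable_EFinP; exact: measurable_log_laplace.
  by rewrite diracT mul1e.
rewrite -(dirac_V _ tf) -(dirac_V _ tc) -!QP//.
apply: ge0_le_integral_nomeas => eta _; first exact: expeR_ge0.
rewrite lee_expeR leeN2; apply: ge0_le_integral_nomeas => y _.
  by rewrite lee_fin ltW.
by rewrite lee_fin lerDl mulr_ge0.
Qed.

(** In the integral equation, [log_laplace_mono] bounds the solution at each earlier time [s] below
    by v_1(s), and the integral of v_1^gamma is v_1(t) - 1. *)
Lemma log_laplace_lower (t b : R) (A : set T) x : 0 < t -> 0 <= b -> measurable A ->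
  ((const_solution gamma 1 t)%:E + b%:E * heat_mass t A x <=
   (V t (fun y => 1 + b * \1_A y) x)%:E)%E.
Proof.
move=> t0 b0 mA; have tf := test_function_affine ltr01 b0 mA.
have [[_ _ _ ->//] _] := VP tf.
rewrite heat_semigroup_affine//.
have -> : ((const_solution gamma 1 t)%:E = 1%:E + (const_solution gamma 1 t - 1)%:E)%E.
  by rewrite -EFinD subrKC.
rewrite -addeA [X in (_ + X <= _)%E]addeC addeA; apply: leeD => //.
rewrite -integral_const_solution//.
apply: ge0_le_integral_nomeas => [s _|s]; first by rewrite lee_fin powR_ge0.
rewrite /= in_itv/= => /andP[s0 st].
rewrite -[X in (X <= _)%E](@heat_semigroup_cst _ _ (t - s) _ x) ?subr_gt0 ?powR_ge0//.
apply: ge0_le_integral_nomeas => y _.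
  by rewrite lee_fin mulr_ge0 ?heat_kernel_ge0// powR_ge0.
rewrite lee_fin ler_wpM2l ?heat_kernel_ge0//=.
apply: ge0_ler_powR; rewrite ?nnegrE; first exact: ltW.
- by rewrite ltW// const_solution_gt0// ltW.
- by have [[h _ _ _] _] := VP tf; exact: h.
rewrite -(log_laplace_cst gamma_lt1 VP y ltr01 s0).
exact: log_laplace_mono.
Qed.

End transition_estimate.

(** [defect_balance] for extended masses: both sides are 0 when [x] is infinite, and [y <= x]
    excludes an infinite [y] with a finite [x]. *)
Lemma damped_mass_balance (R : realType) (l q : R) (x y : \bar R) :
  0 < l -> 0 <= q -> (0 <= y)%E -> (y <= x)%E ->
  (expeR (- x) * (defect l q (fine y))%:E + (q / l)%:E * expeR (- x) =
   expeR (- x) * y + (q / l)%:E * expeR (- (x + (l / q)%:E * y)))%E.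
Proof.
move=> l0 q0; case: x => [x||]; case: y => [y||] //= y0 yx; last 2 first.
- by rewrite !mul0e.
- rewrite addye ?mul0e//.
  by rewrite gt_eqF// (@lt_le_trans _ _ 0%E)// mule_ge0// lee_fin divr_ge0// ltW.
by rewrite -!EFinM -!EFinD defect_balance.
Qed.

Lemma damping_convexe (R : realType) (a : R) (x : \bar R) :
  0 < a -> (0 <= x)%E ->
  ((1 - a)%:E * (expeR (- x) * x) + expeR (- x) <= expeR (- (a%:E * x)))%E.
Proof.
move=> a0; case: x => [x||] //= x0.
  by rewrite -!EFinM -EFinD lee_fin damping_convex.
have -> : (a%:E * +oo = +oo)%E by rewrite gt0_muley ?lte_fin.
by rewrite /= mul0e mule0 adde0.
Qed.

(** * Damped expectations under the transition law [K] from a finite measure [nu] *)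

Section transition_integrals.
Context (R : realType) (d : nat) (gamma : R).
Local Notation T := 'rV[R]_d.
Local Notation state := (measure_space 'rV[R]_d R).
Context (V : R -> (T -> R) -> T -> R) (Q : R -> R.-pker state ~> state).
Hypotheses (gamma_gt0 : 0 < gamma) (gamma_lt1 : gamma < 1).
Hypothesis VP : log_laplace_semigroup gamma V.
Hypothesis QP : log_laplace_transition V Q.
Variables (t : R) (nu : {finite_measure set T -> \bar R}).
Hypothesis t_gt0 : 0 < t.

Local Notation K := (Q t (nu : {measure set T -> \bar R})).
Local Notation N := (fine (nu setT)).
Local Notation leb := (lebesgue_row R d).
Let v a := const_solution gamma a t.
Let C : R := (2 * pi * t) `^ (- (d%:R / 2)).

Let NE : nu setT = N%:E. Proof. by rewrite fineK// fin_num_measure. Qed.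

Let integral_cst_nu (r : R) : (\int[nu]_x r%:E = (r * N)%:E)%E.
Proof. by rewrite EFinM -NE; exact: (integral_cst nu measurableT r%:E). Qed.

Lemma laplace_mass (a : R) : 0 < a ->
  (\int[K]_eta expeR (- (a%:E * (eta : state) setT)) = (expR (- (v a * N)))%:E)%E.
Proof.
move=> a0; transitivity (\int[K]_eta expeR (- \int[eta : state]_x (cst a x)%:E))%E.
  apply: eq_integral => eta _; congr (expeR (- _))%E; apply/esym.
  exact: (integral_cst eta measurableT a%:E).
rewrite QP//; last exact: test_function_cst.
under eq_integral do rewrite (log_laplace_cst gamma_lt1 VP _ a0 t_gt0).
by rewrite integral_cst_nu.
Qed.

(** The mass that [A] receives when [nu] is moved by the heat flow for time [t]. *)
Definition transported_mass (A : set T) : \bar R := (\int[nu]_x heat_mass t A x)%E.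

Lemma transported_mass_ge0 A : (0 <= transported_mass A)%E.
Proof. by apply: integral_ge0 => x _; exact: heat_mass_ge0. Qed.

Lemma transported_mass_ub A : measurable A -> (leb A < +oo)%E ->
  (transported_mass A <= (C * fine (leb A) * N)%:E)%E.
Proof.
move=> mA Afin; rewrite -integral_cst_nu.
apply: ge0_le_integral_nomeas => x _; first exact: heat_mass_ge0.
rewrite EFinM fineK; first exact: heat_mass_ub.
by rewrite ge0_fin_numE.
Qed.

Lemma transported_mass_cells (c : nat -> T -> nat) n :
  (forall k, measurable (cell c n k)) ->
  (\sum_(k <oo) transported_mass (cell c n k) = N%:E)%E.
Proof.
move=> mc; rewrite /transported_mass -integral_nneseries//; last 2 first.
- by move=> k; exact: measurable_heat_mass.
- by move=> k x _; exact: heat_mass_ge0.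
under eq_integral do rewrite heat_mass_cells//.
by rewrite integral_cst_nu mul1r.
Qed.

Lemma laplace_mass_cell (b : R) A : 0 <= b -> measurable A ->
  (\int[K]_eta expeR (- ((eta : state) setT + b%:E * (eta : state) A)) <=
   expeR (- ((v 1 * N)%:E + b%:E * transported_mass A)))%E.
Proof.
move=> b0 mA; have tf := test_function_affine (@ltr01 R) b0 mA.
apply: (@le_trans _ _ (\int[K]_eta expeR (- \int[eta : state]_x (1 + b * \1_A x)%:E))%E).
  apply: ge0_le_integral_nomeas => eta _; first exact: expeR_ge0.
  by rewrite integral_affine_state// mul1e.
rewrite QP// lee_expeR leeN2 -integral_cst_nu.
rewrite -ge0_integralZl//; last 2 first.
- exact: measurable_heat_mass.
- by move=> x _; exact: heat_mass_ge0.
have v0 : 0 <= v 1 by rewrite ltW// const_solution_gt0// ltW.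
rewrite -ge0_integralD//; last 2 first.
- by move=> x _; rewrite mule_ge0// heat_mass_ge0.
- by apply: measurable_funeM; exact: measurable_heat_mass.
apply: ge0_le_integral_nomeas => x _.
  by rewrite adde_ge0// ?lee_fin// mule_ge0// heat_mass_ge0.
exact: (log_laplace_lower gamma_gt0 gamma_lt1 VP QP x t_gt0 b0 mA).
Qed.

Local Notation damped f := (\int[K]_eta (expeR (- (eta : state) setT) * f (eta : state)))%E.

Let mdamp : measurable_fun [set: state] (fun eta : state => expeR (- eta setT)%E).
Proof.
apply: measurable_expeRN => // ; exact: measurable_measure_space_eval.
Qed.

Let laplace_mass1 :
  (\int[K]_eta expeR (- (eta : state) setT) = (expR (- (v 1 * N)))%:E)%E.
Proof.
by rewrite -laplace_mass//; apply: eq_integral => eta _; rewrite mul1e.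
Qed.

Let mdamped_eval A : measurable A ->
  measurable_fun [set: state] (fun eta : state => expeR (- eta setT) * eta A)%E.
Proof.
by move=> mA; apply: emeasurable_funM => //; exact: measurable_measure_space_eval.
Qed.

(** [damping_convexe] integrated against [K]; [laplace_mass] evaluates both exponentials. *)
Lemma damped_total_mass (a : R) : 0 < a -> a < 1 ->
  ((1 - a)%:E * damped (fun eta : state => eta setT) + (expR (- (v 1 * N)))%:E <=
   (expR (- (v a * N)))%:E)%E.
Proof.
move=> a0 a1; rewrite -[X in (_ + X <= _)%E]laplace_mass1.
rewrite -[X in (_ <= X)%E](laplace_mass a0).
have a10 : 0 <= 1 - a by rewrite subr_ge0 ltW.
rewrite -ge0_integralZl//; last 2 first.
- exact: mdamped_eval.
- by move=> eta _; rewrite mule_ge0// expeR_ge0.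
rewrite -ge0_integralD//; last 3 first.
- by move=> eta _; rewrite !mule_ge0// ?lee_fin// expeR_ge0.
- by apply: measurable_funeM; exact: mdamped_eval.
- by move=> eta _; exact: expeR_ge0.
apply: ge0_le_integral_nomeas => eta _.
  by rewrite adde_ge0// ?expeR_ge0// !mule_ge0// ?lee_fin// expeR_ge0.
exact: damping_convexe.
Qed.

(** Integrate the balance identity and bound its Laplace term by [laplace_mass_cell] with
    [b = l / q]. With M the transported mass and u = l M / q, the loss in u - u^2 <= 1 - e^{-u}
    costs (q / l) u^2 <= l C N M, because M <= C q N. *)
Lemma damped_cell_defect (l : R) A : 0 < l -> measurable A -> (leb A < +oo)%E ->
  (damped (fun eta : state => (defect l (fine (leb A)) (fine (eta A)))%:E) +
   (expR (- (v 1 * N)))%:E * transported_mass A <=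
   damped (fun eta : state => eta A) +
   (expR (- (v 1 * N)) * (l * C * N))%:E * transported_mass A)%E.
Proof.
move=> l0 mA Afin; set q := fine (leb A).
have q0 : 0 <= q by rewrite fine_ge0.
have dge0 (eta : state) : 0 <= defect l q (fine (eta A)).
  by rewrite defect_ge0// fine_ge0.
have bal : (damped (fun eta : state => (defect l q (fine (eta A)))%:E) +
    (q / l)%:E * (expR (- (v 1 * N)))%:E =
    damped (fun eta : state => eta A) +
    (q / l)%:E * \int[K]_eta expeR (- ((eta : state) setT + (l / q)%:E * (eta : state) A)))%E.
  have ql : 0 <= q / l by rewrite divr_ge0// ltW.
  have lq : 0 <= l / q by rewrite divr_ge0// ltW.
  have m2 : measurable_fun [set: state]
      (fun eta : state => expeR (- (eta setT + (l / q)%:E * eta A))%E).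
    apply: measurable_expeRN => [|eta].
      apply: emeasurable_funD; first exact: measurable_measure_space_eval.
      by apply: measurable_funeM; exact: measurable_measure_space_eval.
    by rewrite adde_ge0// mule_ge0.
  rewrite -laplace_mass1 -!ge0_integralZl//; last 2 first.
  - by move=> eta _; exact: expeR_ge0.
  - by move=> eta _; exact: expeR_ge0.
  rewrite -!ge0_integralD//; last 8 first.
  - by move=> eta _; rewrite mule_ge0// expeR_ge0.
  - exact: mdamped_eval.
  - by move=> eta _; rewrite mule_ge0// expeR_ge0.
  - exact: measurable_funeM.
  - by move=> eta _; rewrite mule_ge0// ?expeR_ge0// lee_fin.
  - by apply: emeasurable_funM => //; exact: measurable_defect.
  - by move=> eta _; rewrite mule_ge0// expeR_ge0.
  - exact: measurable_funeM.
  apply: eq_integral => eta _; apply: damped_mass_balance => //.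
  by apply: le_measure; rewrite ?inE.
have lq0 : 0 <= l / q by rewrite divr_ge0// ltW.
have := laplace_mass_cell lq0 mA; move: bal.
have Mub := transported_mass_ub mA Afin.
have Mfin : transported_mass A \is a fin_num.
  by rewrite ge0_fin_numE ?transported_mass_ge0// (le_lt_trans Mub)// ltry.
rewrite -(fineK Mfin) in Mub *; set M := fine (transported_mass A) in Mub *.
have M0 : 0 <= M by rewrite fine_ge0// transported_mass_ge0.
set W := integral K setT (fun eta => _ * (defect _ _ _)%:E)%E.
set I2 := integral K setT (fun eta => expeR (- (_ + _)))%E.
set U := integral K setT _.
have W0 : (0 <= W)%E.
  by apply: integral_ge0 => eta _; rewrite mule_ge0// ?expeR_ge0// lee_fin.
have U0 : (0 <= U)%E by apply: integral_ge0 => eta _; rewrite mule_ge0// expeR_ge0.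
have I0 : (0 <= I2)%E by apply: integral_ge0 => eta _; exact: expeR_ge0.
clearbody W I2 U.
case: U U0 => [U|_|]//; last first.
  by move=> _ _; rewrite -[X in (_ <= _ + X)%E]EFinM [X in (_ <= X)%E]addye ?leey.
case: I2 I0 => [I2||]//.
case: W W0 => [W||]//.
rewrite -!EFinM -!EFinD /= !lee_fin => W0 I20 U0 [] bal I2ub.
have Mub' : M <= C * q * N by rewrite -lee_fin.
have v10 : 0 < expR (- (v 1 * N)) := expR_gt0 _.
move: q0 lq0 bal I2ub Mub'; rewrite /= opprD expRD.
set e1 := expR (- (v 1 * N)) in v10 *.
(* On a null cell the bound M <= C q N forces M = 0, and the balance reduces to W = U. *)
rewrite le_eqVlt => /predU1P[<-|q0] lq0 bal I2ub Mub'.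
  have M00 : M = 0 by apply/eqP; rewrite eq_le M0 andbT; rewrite mulr0 mul0r in Mub'.
  by move: bal; rewrite M00 !mul0r !mulr0 !addr0 => ->.
have qM : q / l * (l / q * M) = M by field; rewrite !gt_eqF.
have qM2 : q / l * (l / q * M) ^+ 2 <= l * C * N * M.
  have -> : q / l * (l / q * M) ^+ 2 = l * M * (M / q) by field; rewrite !gt_eqF.
  have -> : l * C * N * M = l * M * (C * N) by ring.
  rewrite ler_wpM2l ?mulr_ge0 ?(ltW l0)// ler_pdivrMr//.
  by rewrite mulrAC.
have u0 : 0 <= l / q * M by rewrite mulr_ge0.
have ql : 0 < q / l by rewrite divr_gt0.
have h1 : q / l * I2 <= q / l * (e1 * expR (- (l / q * M))) by rewrite ler_pM2l.
have h2 : M - l * C * N * M <= q / l * (1 - expR (- (l / q * M))).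
  have := onem_expR_ge u0; rewrite -(ler_pM2l ql); apply: le_trans.
  by rewrite mulrBr qM; lra.
have h3 : e1 * (M - l * C * N * M) <= e1 * (q / l * (1 - expR (- (l / q * M)))).
  by rewrite ler_pM2l.
have h4 : q / l * (e1 * expR (- (l / q * M))) + e1 * (q / l * (1 - expR (- (l / q * M))))
    = q / l * e1 by ring.
have h5 : e1 * (M - l * C * N * M) = e1 * M - e1 * (l * C * N) * M by ring.
lra.
Qed.

Let damped_sum (f : nat -> state -> \bar R) :
  (forall k, measurable_fun [set: state] (f k)) -> (forall k eta, (0 <= f k eta)%E) ->
  damped (fun eta => (\sum_(k <oo) f k eta)%E) = (\sum_(k <oo) damped (f k))%E.
Proof.
move=> mf f0; rewrite -integral_nneseries//; last 2 first.
- by move=> k; exact: emeasurable_funM.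
- by move=> k eta _; rewrite mule_ge0// expeR_ge0.
apply: eq_integral => eta _.
have expeRN_fin (x : \bar R) : (0 <= x)%E -> expeR (- x)%E \is a fin_num.
  by case: x.
rewrite -[X in (X * _)%E]fineK; last exact/expeRN_fin.
rewrite -nneseriesZl//; apply: eq_eseriesr => k _.
by rewrite fineK//; exact/expeRN_fin.
Qed.

(** [damped_cell_defect] summed over the cells. The transported masses add up to [N] at every level,
    so the error term does not depend on [n]. *)
Lemma damped_total_defect (c : nat -> T -> nat) (l : R) n : 0 < l ->
  (forall i k, measurable (cell c i k)) -> (forall i k, leb (cell c i k) < +oo)%E ->
  (damped (fun eta : state => total_defect leb c l n eta) +
   (expR (- (v 1 * N)) * N)%:E <=
   damped (fun eta : state => eta setT) +
   (expR (- (v 1 * N)) * (l * C * N ^+ 2))%:E)%E.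
Proof.
move=> l0 mc cfin; set e1 := expR (- (v 1 * N)).
have e10 : 0 <= e1 := expR_ge0 _.
have dge0 k (eta : state) :
    (0 <= (defect l (fine (leb (cell c n k))) (fine (eta (cell c n k))))%:E)%E.
  by rewrite lee_fin defect_ge0// fine_ge0.
have lCN0 : 0 <= l * C * N by rewrite !mulr_ge0 ?powR_ge0 ?fine_ge0 ?(ltW l0).
have -> : damped (fun eta : state => total_defect leb c l n eta) =
    (\sum_(k <oo) damped (fun eta : state =>
      (defect l (fine (leb (cell c n k))) (fine (eta (cell c n k))))%:E))%E.
  rewrite -(@damped_sum (fun k (eta : state) =>
      (defect l (fine (leb (cell c n k))) (fine (eta (cell c n k))))%:E))//.
  by move=> k; exact: measurable_defect.
have -> : damped (fun eta : state => eta setT) =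
    (\sum_(k <oo) damped (fun eta : state => eta (cell c n k)))%E.
  rewrite -(@damped_sum (fun k (eta : state) => eta (cell c n k)))//; last first.
    by move=> k; exact: measurable_measure_space_eval.
  by apply: eq_integral => eta _; rewrite (measure_setT_cells mc _ n).
have sumM (r : R) : ((r * N)%:E = \sum_(k <oo) r%:E * transported_mass (cell c n k))%E.
  rewrite nneseriesZl ?(transported_mass_cells (mc n))// => k _.
  exact: transported_mass_ge0.
rewrite (_ : e1 * (l * C * N ^+ 2) = e1 * (l * C * N) * N); last by ring.
rewrite !sumM.
have damped_ge0 (f : state -> \bar R) : (forall eta, (0 <= f eta)%E) -> (0 <= damped f)%E.
  by move=> f0; apply: integral_ge0 => eta _; rewrite mule_ge0// expeR_ge0.
rewrite -!nneseriesD; last 4 first.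
- by move=> k _ _; exact: damped_ge0.
- by move=> k _ _; rewrite mule_ge0 ?transported_mass_ge0// lee_fin mulr_ge0.
- by move=> k _ _; exact: damped_ge0.
- by move=> k _ _; rewrite mule_ge0 ?transported_mass_ge0// lee_fin.
apply: lee_nneseries => [k _ _|k _].
  by rewrite adde_ge0 ?damped_ge0// mule_ge0 ?transported_mass_ge0// lee_fin.
exact: damped_cell_defect.
Qed.

Lemma damped_total_defect_le (c : nat -> T -> nat) (a l e : R) n :
  2^-1 <= a -> a < 1 -> 0 <= e -> 0 < l -> l * C <= e ->
  v 1 - v a <= (1 + e) * (1 - a) -> v 1 - v a <= e ->
  (forall i k, measurable (cell c i k)) -> (forall i k, leb (cell c i k) < +oo)%E ->
  (damped (fun eta : state => total_defect leb c l n eta) <= (34 * e)%:E)%E.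
Proof.
move=> a2 a1 e0 l0 lCe slope gap mc cfin.
have a0 : 0 < a by rewrite (lt_le_trans _ a2)// invr_gt0.
have va : 2^-1 <= v a by rewrite (le_trans a2)// ge_const_solution// ltW.
have N0 : 0 <= N by rewrite fine_ge0.
have lC0 : 0 <= l * C by rewrite mulr_ge0 ?powR_ge0// ltW.
have a10 : 0 < 1 - a by rewrite subr_gt0.
(* The last inequality forces [U] to be finite and the one before it then forces [W] to be finite,
   so the real estimate applies. *)
have concl (U W : \bar R) : (0 <= U)%E -> (0 <= W)%E ->
    (W + (expR (- (v 1 * N)) * N)%:E <= U + (expR (- (v 1 * N)) * (l * C * N ^+ 2))%:E)%E ->
    ((1 - a)%:E * U + (expR (- (v 1 * N)))%:E <= (expR (- (v a * N)))%:E)%E ->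
    (W <= (34 * e)%:E)%E.
  case: U => [U||]//; last by move=> _ _ _; rewrite gt0_muley ?lte_fin// addye.
  case: W => [W||]//.
  rewrite -!EFinM -!EFinD !lee_fin => _ _ HW HU.
  have va1 : v a <= v 1 by apply: const_solution_homo => //; exact: ltW.
  move: va va1 slope gap HW HU; move: (v a) (v 1) => wa w1 wa2 wa1 slope gap HW HU.
  exact: (defect_estimate N0 e0 a1 wa2 wa1 slope gap lC0 lCe HU HW).
apply: (concl (damped (fun eta : state => eta setT))).
- by apply: integral_ge0 => eta _; rewrite mule_ge0// expeR_ge0.
- apply: integral_ge0 => eta _; rewrite mule_ge0 ?expeR_ge0//.
  by apply: nneseries_ge0 => k _ _; rewrite lee_fin defect_ge0// fine_ge0.
- exact: damped_total_defect.
- exact: damped_total_mass.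
Qed.

End transition_integrals.

(** * The Markov property for nonnegative functions *)

Section markov_integral.
Import HBNNSimple.

(** Linearity extends the identity for sets to simple functions. A simple function below [g] has
    integral at most [b] under each [kappa (Xs w)] with [w] in [A], and the integral of [g] is the
    supremum over such functions. *)
Lemma markov_integral_le dO (Omega : measurableType dO) (R : realType)
    (P : probability Omega R) dE (E : measurableType dE) (kappa : R.-pker E ~> E)
    (Xs Xt : Omega -> E) (A : set Omega) (g : E -> \bar R) (b : \bar R) :
  measurable_fun setT Xs -> measurable_fun setT Xt -> measurable A ->
  (forall B, measurable B -> P (A `&` Xt @^-1` B) = (\int[P]_(w in A) kappa (Xs w) B)%E) ->
  measurable_fun setT g -> (forall x, 0 <= g x)%E -> (0 <= b)%E ->
  (forall w, A w -> (\int[kappa (Xs w)]_x g x <= b)%E) ->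
  (\int[P]_(w in A) g (Xt w) <= b)%E.
Proof.
move=> mXs mXt mA mP mg g0 b0 gb.
have mE : measurable_fun A Xt by exact: measurable_funTS.
pose Xt' : {mfun Omega >-> E} := HB.pack Xt (isMeasurableFun.Build _ _ _ _ Xt mXt).
pose law := pushforward (mrestr P mA) Xt'.
have lawE B : law B = P (Xt @^-1` B `&` A) by [].
have -> : (\int[P]_(w in A) g (Xt w) = \int[mrestr P mA]_(w in A) g (Xt w))%E.
  apply: eq_measure_integral => B mB BA.
  by rewrite /= /mrestr setIidl.
have mgX : measurable_fun setT (g \o Xt) by exact: measurableT_comp.
apply: (@le_trans _ _ (\int[mrestr P mA]_w (g \o Xt) w)%E).
  by apply: ge0_subset_integral.
rewrite -[X in (integral _ X _ <= _)%E](preimage_setT Xt).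
rewrite -(@ge0_integral_pushforward _ _ _ _ _ Xt)// -/law.
rewrite ge0_integralTE//; apply: ge_ereal_sup => _ [h hg <-].
rewrite sintegralE.
pose F (r : R) w := (r%:E * kappa (Xs w) (h @^-1` [set r]))%E.
have mF r : measurable_fun A (F r).
  apply: measurable_funeM; apply: measurable_funTS.
  exact: (measurableT_comp (measurable_kernel kappa _ _) mXs).
have F0 r w : (0 <= F r w)%E.
  rewrite /F; have [r0|r0] := leP 0 r; first by rewrite mule_ge0.
  by rewrite preimage_nnfun0// measure0 mule0.
rewrite (eq_fsbigr (fun r => \int[P]_(w in A) F r w)%E); last first.
  move=> r _; rewrite [X in (_ * X)%E]lawE setIC mP// /F.
  have [r0|r0] := leP 0 r; last first.
    by rewrite preimage_nnfun0// !integral0_eq ?mule0// => w _; rewrite measure0 ?mule0.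
  rewrite ge0_integralZl// .
  apply: measurable_funTS.
  exact: (measurableT_comp (measurable_kernel kappa _ _) mXs).
rewrite -ge0_integral_fsum//.
apply: (@le_trans _ _ (\int[P]_(w in A) b)%E).
  apply: ge0_le_integral_nomeas => w Aw; first by apply: fsume_ge0.
  rewrite -sintegralE; apply: le_trans (gb w Aw).
  rewrite -integralT_nnsfun; apply: ge0_le_integral_nomeas => x _ //.
  by rewrite lee_fin.
rewrite integral_cst//; apply: (@le_trans _ _ (b * 1)%E); last by rewrite mule1.
by apply: lee_wpmul2l => //; exact: probability_le1.
Qed.

End markov_integral.

(** * Eventual lower bounds and negligible sets *)

Lemma chebyshev_ge0 d (T : measurableType d) (R : realType)
    (P : {measure set T -> \bar R}) (f : T -> \bar R) (r : R) :
  0 <= r -> measurable_fun setT f -> (forall w, 0 <= f w)%E ->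
  (r%:E * P [set w | r%:E <= f w]%E <= \int[P]_w f w)%E.
Proof.
move=> r0 mf f0.
have mB : measurable [set w | (r%:E <= f w)%E].
  rewrite -[X in measurable X]setTI; exact: emeasurable_fun_c_infty.
rewrite -integral_cst// integral_mkcond; apply: ge0_le_integral_nomeas => w _.
  by rewrite patchE; case: ifP.
by rewrite patchE; case: ifP => //; rewrite inE.
Qed.

(** [r] does not depend on [j], so [j] may be chosen after it to make the integrals small uniformly
    in [n]. Chebyshev bounds the probability at each [n], and continuity along increasing sets
    bounds that of the eventual event. *)
Lemma negligible_liminf d (T : measurableType d) (R : realType)
    (P : probability T R) (f : nat -> nat -> T -> \bar R) :
  (forall j n, measurable_fun setT (f j n)) -> (forall j n w, 0 <= f j n w)%E ->
  (forall e : R, 0 < e -> exists j, forall n, (\int[P]_w f j n w <= e%:E)%E) ->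
  P.-negligible [set w | exists2 r : R, 0 < r &
    forall j, exists n0, forall n, (n0 <= n)%N -> (r%:E <= f j n w)%E].
Proof.
move=> mf f0 fe.
pose B k j n := [set w | (k.+1%:R^-1%:E <= f j n w)%E].
have mB k j n : measurable (B k j n).
  rewrite -[X in measurable X]setTI; exact: emeasurable_fun_c_infty.
pose S k j N := \bigcap_(n in [set n | (N <= n)%N]) B k j n.
have mS k j N : measurable (S k j N).
  by apply: bigcap_measurable => //; exists N => /=.
pose Z k := \bigcap_j \bigcup_N S k j N.
have mZ k : measurable (Z k).
  by apply: bigcapT_measurable => j; exact: bigcupT_measurable.
apply: (@negligibleS _ _ _ P (\bigcup_k Z k)).
  move=> w [r r0 h]; have [k kr] := ltr_add_invr r0; rewrite add0r in kr.
  exists k => // j _; have [n0 hn] := h j; exists n0 => // n /= n0n.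
  by rewrite /B/=; apply: le_trans (hn n n0n); rewrite lee_fin ltW.
apply: negligible_bigcup => k; apply/negligibleP => //.
apply/eqP; rewrite eq_le measure_ge0 andbT; apply/lee_addgt0Pr => e e0; rewrite add0e.
(* Chebyshev at the threshold 1 / (k + 1) multiplies the integral by k + 1. *)
have ek0 : 0 < e / k.+1%:R by rewrite divr_gt0.
have [j hj] := fe _ ek0.
have PB n : (P (B k j n) <= e%:E)%E.
  have k0 : (0 : R) <= k.+1%:R^-1 by rewrite invr_ge0.
  have := le_trans (chebyshev_ge0 P k0 (mf j n) (f0 j n)) (hj n).
  by rewrite muleC EFinM lee_pmul2r// lte_fin invr_gt0.
apply: (@le_trans _ _ (P (\bigcup_N S k j N))).
  by apply: le_measure; rewrite ?inE//; [exact: bigcupT_measurable|exact: bigcap_inf].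
have cS : P (S k j N) @[N --> \oo] --> P (\bigcup_N S k j N).
  apply: nondecreasing_cvg_mu => //; first exact: bigcupT_measurable.
  move=> N M NM; apply/subsetPset => w h n /= Mn; apply: h => /=.
  exact: leq_trans Mn.
rewrite -(cvg_lim _ cS)//.
apply: lime_le; first by apply/cvg_ex; exists (P (\bigcup_N S k j N)).
near=> N; apply: le_trans (PB N); apply: le_measure; rewrite ?inE//.
by move=> w h; apply: h => /=.
Unshelve. all: by end_near. Qed.

(** * Smallness of the damped defect, uniform in the initial measure and the cube size *)

Section uniform_defect.
Context (R : realType) (d : nat) (gamma : R).
Local Notation T := 'rV[R]_d.
Local Notation state := (measure_space 'rV[R]_d R).
Local Notation leb := (lebesgue_row R d).

Definition damped_defect (l : R) (n : nat) (eta : state) : \bar R :=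
  (expeR (- eta setT) * total_defect leb (@dyadic R d) l n eta)%E.

Lemma damped_defect_ge0 l n eta : 0 < l -> (0 <= damped_defect l n eta)%E.
Proof.
move=> l0; rewrite mule_ge0 ?expeR_ge0//.
by apply: nneseries_ge0 => k _ _; rewrite lee_fin defect_ge0// fine_ge0.
Qed.

Lemma measurable_damped_defect l n : 0 < l ->
  measurable_fun [set: state] (damped_defect l n).
Proof.
move=> l0; apply: emeasurable_funM.
  by apply: measurable_expeRN => //; exact: measurable_measure_space_eval.
by apply: measurable_total_defect => // k; exact: measurable_dyadic_cell.
Qed.

Context (V : R -> (T -> R) -> T -> R) (Q : R -> R.-pker state ~> state).
Hypotheses (gamma_gt0 : 0 < gamma) (gamma_lt1 : gamma < 1).
Hypothesis VP : log_laplace_semigroup gamma V.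
Hypothesis QP : log_laplace_transition V Q.

(** The factor 34 is absorbed in [e']. The time [delta] is chosen first; then [l = e' / C]
    compensates the bound [C] of the heat kernel at time [delta]. *)
Lemma uniformly_small_defect (e t : R) : 0 < e -> 0 < t ->
  exists delta l : R, [/\ 0 < delta, delta <= t, 0 < l &
    forall (nu : state) n, (nu setT < +oo)%E ->
      (\int[Q delta nu]_eta damped_defect l n eta <= e%:E)%E].
Proof.
move=> e0 t0; pose e' := Num.min 1 (e / 34).
have e'0 : 0 < e' by rewrite lt_min ltr01 divr_gt0.
have e'1 : e' <= 1 by rewrite ge_min lexx.
have e'e : 34 * e' <= e.
  have : e' <= e / 34 by rewrite ge_min lexx orbT.
  by rewrite ler_pdivlMr// mulrC.
have [a [delta [a2 a1 d0 dt /andP[slope gap]]]] :=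
  small_parameters gamma_gt0 gamma_lt1 e'0 e'1 t0.
pose C : R := (2 * pi * delta) `^ (- (d%:R / 2)).
have C0 : 0 < C by rewrite powR_gt0// !mulr_gt0// pi_gt0.
exists delta, (e' / C); split=> //; first exact: divr_gt0.
move=> nu n nufin; apply: (@le_trans _ _ (34 * e')%:E); last by rewrite lee_fin.
have := @damped_total_defect_le R d gamma V Q gamma_gt0 gamma_lt1 VP QP delta
  (finite_measure_of nufin) d0 (@dyadic R d) a (e' / C) e' n a2 a1 (ltW e'0).
rewrite finite_measure_ofE; apply.
- exact: divr_gt0.
- by rewrite divfK// gt_eqF.
- exact: slope.
- exact: le_trans slope gap.
- exact: measurable_dyadic_cell.
- exact: lebesgue_dyadic_cell.
Qed.

End uniform_defect.

(** * Absolute continuity at a fixed time before explosion *)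

Theorem theorem1p2 (R : realType) (d : nat) (gamma : R)
    (V : R -> ('rV[R]_d -> R) -> 'rV[R]_d -> R)
    (dO : measure_display) (Omega : measurableType dO) (P : probability Omega R)
    (F : R -> set_system Omega)
    (X : R -> Omega -> measure_space 'rV[R]_d R)
    (mu : {finite_measure set 'rV[R]_d -> \bar R}) :
  (1 <= d)%N -> 0 < gamma -> gamma < 1 ->
  log_laplace_semigroup gamma V ->
  super_brownian_motion V P F X ->
  {ae P, forall w, measure_eq (X 0 w) mu} ->
  forall t : R, 0 < t ->
    {ae P, forall w, (t%:E < explosion_time X (cst 1%R) w)%E ->
      X t w `<< lebesgue_row R d}.
Proof.
move=> _ g0 g1 VP [[_ Fm _] adX [Q [_ QP markovX]]] _ t t0.
have mX s : 0 <= s -> measurable_fun setT (X s).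
  by move=> s0 _ B mB; rewrite setTI; apply: (Fm s s0); exact: adX.
have par : forall j, exists dl : R * R, [/\ 0 < dl.1, dl.1 <= t, 0 < dl.2 &
    forall (nu : measure_space 'rV[R]_d R) n, (nu setT < +oo)%E ->
      (\int[Q dl.1 nu]_eta damped_defect dl.2 n eta <= j.+1%:R^-1%:E)%E].
  move=> j; have j0 : (0 : R) < j.+1%:R^-1 by rewrite invr_gt0.
  have [delta [l h]] := uniformly_small_defect g0 g1 VP QP j0 t0.
  by exists (delta, l).
have [dl parP] := choice par.
pose delta j := (dl j).1; pose l j := (dl j).2.
pose s j := t - delta j.
have s0 j : 0 <= s j by rewrite subr_ge0; case: (parP j).
have st j : s j <= t by rewrite lerBlDr lerDl; case: (parP j) => /ltW.
have tsj j : t - s j = delta j by rewrite /s subKr.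
(* The estimate from time [s j] to time [t] holds for finite starting measures only, hence the
   restriction to this event of [F (s j)]. *)
pose A j := X (s j) @^-1` [set nu | (nu setT < +oo)%E].
have mfin : measurable [set nu : measure_space 'rV[R]_d R | (nu setT < +oo)%E].
  rewrite -[X in measurable X]setTI; apply: emeasurable_fun_infty_o => //.
  exact: measurable_measure_space_eval.
have FA j : F (s j) (A j) by exact: adX.
have mA j : measurable (A j) by exact: Fm (FA j).
pose f j n := (fun w => damped_defect (l j) n (X t w)) \_ (A j).
have l0 j : 0 < l j by case: (parP j).
have mD j n : measurable_fun setT (fun w => damped_defect (l j) n (X t w)).
  exact: (measurableT_comp (measurable_damped_defect n (l0 j)) (mX t (ltW t0))).
have f0 j n w : (0 <= f j n w)%E.
  by rewrite /f patchE; case: ifP => // _; exact: damped_defect_ge0.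
(* The exceptional set is contained in the event that the damped defects stay, for every [j] and all
   fine enough levels, above a positive [r] independent of [j]. *)
apply: (@negligibleS _ _ _ P [set w | exists2 r : R, 0 < r &
    forall j, exists n0, forall n, (n0 <= n)%N -> (r%:E <= f j n w)%E]); last first.
  apply: negligible_liminf => //.
  - move=> j n; apply/(measurable_restrictT _ (mA j)).1.
    exact: measurable_funTS.
  - move=> e e0; have [j je] := ltr_add_invr e0; rewrite add0r in je.
    exists j => n; apply: (@le_trans _ _ j.+1%:R^-1%:E); last by rewrite lee_fin ltW.
    rewrite /f -integral_mkcond.
    apply: (@markov_integral_le _ _ _ P _ _ (Q (delta j)) (X (s j)) (X t) (A j)) => //.
    + exact: mX.
    + by apply: mX; exact: ltW.
    + by move=> B mB; rewrite (markovX (s j) t)// tsj.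
    + exact: measurable_damped_defect.
    + by move=> eta; exact: damped_defect_ge0.
    + by move=> w Aw; have [_ _ _] := parP j; apply.
move=> w /= /not_implyP[tT nac].
(* An infinite mass at a time [r <= t] would place the explosion time at or before [t]. Hence [w]
   lies in every [A j]. *)
have Xfin r : 0 <= r -> r <= t -> (X r w setT < +oo)%E.
  move=> r0 rt; rewrite ltNge leye_eq; apply/negP => /eqP Xoo.
  move: tT; rewrite ltNge => /negP; apply.
  apply: (@le_trans _ _ r%:E); last by rewrite lee_fin.
  apply: ereal_inf_lbound; exists r => //; split => //.
  by rewrite -Xoo -[RHS]mul1e; exact: (integral_cst (X r w) measurableT 1%E).
have Xtfin := Xfin t (ltW t0) (lexx t).
(* The singular part of [X t w] provides an [r] valid for all [l], hence for every [l j]. *)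
have [r r0 rP] := @total_defect_bounded_below _ _ _ (lebesgue_row R d) (@dyadic R d)
  (@measurable_dyadic_cell R d) (@lebesgue_dyadic_cell R d) (@dyadic_refine R d)
  (@measurable_dyadic_generate R d) (finite_measure_of Xtfin) nac.
rewrite finite_measure_ofE in rP.
have Em : expeR (- X t w setT) = (expR (- fine (X t w setT)))%:E.
  by rewrite -[in LHS](@fineK _ (X t w setT))// ge0_fin_numE.
(* The damping factor at [w] is positive because the mass at time [t] is finite, and it does not
   depend on [j]. *)
exists (expR (- fine (X t w setT)) * r); first by rewrite mulr_gt0 ?expR_gt0.
move=> j; have [n0 n0P] := rP (l j) (l0 j); exists n0 => n n0n.
rewrite /f patchE mem_set; last by rewrite /A/=; exact: Xfin.
by rewrite /damped_defect Em EFinM; apply: lee_wpmul2l; [rewrite lee_fin expR_ge0|exact: n0P].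
Qed.
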